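(* Let $0\le x<y\le N$ with $y-x\in\{2,4,\dots,\rho\}$. Then there exists a Markovian coupling $(X,Y)$ for $p$ with $(X_0,Y_0)=(x,y)$ whose coupling time $\tau=\inf\{t:X_t=Y_t\}$ is stochastically dominated by the sum of $m=\lfloor 6+N/(\rho+1)\rfloor$ independent copies of $T(L_0)$; that is, if $T_1,\dots,T_m$ are independent, each distributed as $T(L_0)$, then $P_{x,y}(\tau>t)\le P(T_1+\dots+T_m>t)$ for all $t\in\mathbb{Z}_+$.
   Context: Let $N\in 4\mathbb{N}$, let $\mathcal{S}_N=\{0,\dots,N\}$, and let $J_0,J_N\in\{3,5,\dots,N-3\}$ (odd integers). Put $\nu_0=\delta_{J_0}$, $\nu_N=\delta_{J_N}$ (point masses). The transition function $p$ on $\mathcal{S}_N$ is $$p(x,y)=\begin{cases}\frac12 & x=y\\ \frac14 & |x-y|=1\\ \frac14\nu_x(y) & x\in\{0,N\},\ |y-x|>1\end{cases}$$ and $p(x,y)=0$ otherwise. (So from $0$ the chain jumps to $J_0$ with probability $\frac14$, and from $N$ it jumps to $J_N$ with probability $\frac14$.) Define $\rho=2\left\lfloor \tfrac12\min\{x,N-x:\nu_0(x)+\nu_N(x)>0\}\right\rfloor$, i.e. $\rho=2\lfloor\frac12\min\{J_0,N-J_0,J_N,N-J_N\}\rfloor$, and $$L_0=\tfrac12\max\{J_0-1,\;N-1-J_N,\;N+J_N-J_0\},$$ which is a positive integer. A coupling for $p$ is an $\mathcal{S}_N^2$-valued process $(X,Y)=\{(X_n,Y_n):n\in\mathbb{Z}_+\}$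 such that both marginal processes $X$ and $Y$ are Markov chains with transition function $p$. Only coalescing couplings are considered: if $X_n=Y_n$ for some $n$, then $X_k=Y_k$ for all $k\ge n$. A coupling is Markovian if $(X,Y)$, $X$ and $Y$ are all Markov chains with respect to the filtration generated by $(X,Y)$; in particular $P(X_{n+1}=x'\mid (X_n,Y_n)=(x,y))=p(x,x')$ and $P(Y_{n+1}=y'\mid (X_n,Y_n)=(x,y))=p(y,y')$. $P_{x,y}$ denotes the law of $(X,Y)$ with $X_0=x$, $Y_0=y$. For a positive integer $L$, $T(L)$ denotes a random variable distributed as the first exit time $\inf\{n:Z_n\notin\{1,\dots,L\}\}$, where $Z$ is the lazy random walk on $\mathbb{Z}$ (at each step it stays put with probability $\frac12$ and moves to each of the two neighbors with probability $\frac14$) started from $Z_0=\lfloor (L+1)/2\rfloor$. *)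

(* Defs.v *)
From HB Require Import structures.
From mathcomp Require Import all_boot all_order all_algebra.
From mathcomp Require Import all_classical all_reals all_analysis measurable_realfun.

Set Implicit Arguments.
Unset Strict Implicit.
Unset Printing Implicit Defensive.

Import Order.TTheory GRing.Theory Num.Theory.

Local Open Scope classical_set_scope.
Local Open Scope ring_scope.

Section MarkovChains.
Context (R : realType) (d : measure_display) (Omega : measurableType d).
Context (P : probability Omega R) (S : eqType).

(* For countable [S] this is the sigma-algebra generated by W 0, ..., W n. *)
Definition history (W : nat -> Omega -> S) (n : nat) : set (set Omega) :=
  <<s [set A | exists k s, (k <= n)%N /\ A = W k @^-1` [set s]] >>.

(* The last clause is P(W n.+1 = s' | F n) = p (W n) s', with the conditional
   probability characterized by its integrals over the sets of F n; for
   countable [S] it is enough to test the sets [A `&` (W n = s)].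
   [p] does not depend on n: chains are time-homogeneous. *)
Definition markov_chain_wrt (F : nat -> set (set Omega)) (p : S -> S -> R)
    (W : nat -> Omega -> S) : Prop :=
  [/\ forall n, F n `<=` measurable,
      forall n s, F n (W n @^-1` [set s])
    & forall n A s s', F n A ->
        P (A `&` W n @^-1` [set s] `&` W n.+1 @^-1` [set s'])
        = (P (A `&` W n @^-1` [set s]) * (p s s')%:E)%E].

Definition markov_chain (p : S -> S -> R) (W : nat -> Omega -> S) : Prop :=
  markov_chain_wrt (history W) p W.

End MarkovChains.

Definition stochastic (R : realType) (S : finType) (q : S -> S -> R) : Prop :=
  (forall s s', 0 <= q s s') /\ (forall s, \sum_s' q s s' = 1).

Definition pair_process (Omega S : Type) (X Y : nat -> Omega -> S)
  : nat -> Omega -> S * S := fun n w => (X n w, Y n w).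

Definition coalescing (Omega S : Type) (X Y : nat -> Omega -> S) : Prop :=
  forall w n k, X n w = Y n w -> (n <= k)%N -> X k w = Y k w.

Definition coupling (R : realType) (d : measure_display)
    (Omega : measurableType d) (P : probability Omega R) (S : eqType)
    (p : S -> S -> R) (X Y : nat -> Omega -> S) : Prop :=
  [/\ markov_chain P p X, markov_chain P p Y & coalescing X Y].

Definition markovian_coupling (R : realType) (d : measure_display)
    (Omega : measurableType d) (P : probability Omega R) (S : finType)
    (p : S -> S -> R) (X Y : nat -> Omega -> S) : Prop :=
  let W := pair_process X Y in
  [/\ coupling P p X Y,
      exists q : S * S -> S * S -> R,
        stochastic q /\ markov_chain_wrt P (history W) q W,
      markov_chain_wrt P (history W) p X
    & markov_chain_wrt P (history W) p Y].

(* Equal to +oo when [E] is empty. *)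
Definition first_time (R : realType) (E : set nat) : \bar R :=
  ereal_inf [set (n%:R : R)%:E | n in E].

Definition coupling_time (R : realType) (Omega S : Type)
    (X Y : nat -> Omega -> S) (w : Omega) : \bar R :=
  first_time R [set n | X n w = Y n w].

Definition exit_time (R : realType) (Omega : Type) (L : nat)
    (Z : nat -> Omega -> int) (w : Omega) : \bar R :=
  first_time R [set n | ~~ (1 <= Z n w <= L%:Z)].

Definition lazy_walk_step (R : realType) (z z' : int) : R :=
  if z == z' then 2^-1 else if `|z - z'| == 1 then 4^-1 else 0.

Definition lazy_walk_from (R : realType) (d : measure_display)
    (Omega : measurableType d) (P : probability Omega R) (z0 : int)
    (Z : nat -> Omega -> int) : Prop :=
  (forall w, Z 0%N w = z0) /\ markov_chain P (@lazy_walk_step R) Z.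

Definition mutually_independent (R : realType) (d : measure_display)
    (Omega : measurableType d) (P : probability Omega R) (I : finType)
    (T : I -> Omega -> \bar R) : Prop :=
  forall (J : {set I}) (A : I -> set (\bar R)),
    (forall i, measurable (A i)) ->
    P (\bigcap_(i in [set` J]) (T i @^-1` A i))
    = (\prod_(i in J) P (T i @^-1` A i))%E.

(* [T] is distributed as the exit time T(L); the walk [Z] realizing T(L) may
   live on a different probability space. *)
Definition distributed_as_exit_time (R : realType)
    (d : measure_display) (Omega : measurableType d) (P : probability Omega R)
    (d' : measure_display) (Omega' : measurableType d')
    (P' : probability Omega' R)
    (L : nat) (Z : nat -> Omega' -> int) (T : {RV P >-> \bar R}) : Prop :=
  lazy_walk_from P' ((L.+1)./2)%:Z Z /\
  forall A : set (\bar R), measurable A ->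
    distribution P T A = P' (exit_time R L Z @^-1` A).

Section Model.
Context (N J0 JN : nat).

Definition jump_law (R : realType) (x y : nat) : R :=
  if x == 0%N then (y == J0)%:R else (y == JN)%:R.

Definition trans (R : realType) (x y : 'I_N.+1) : R :=
  let dist := `|(x : nat)%:Z - (y : nat)%:Z|%N in
  if dist == 0%N then 2^-1
  else if dist == 1%N then 4^-1
  else if ((x : nat) == 0%N) || ((x : nat) == N) then 4^-1 * jump_law R x y
  else 0.

Definition rho : nat :=
  2 * (minn (minn J0 (N - J0)) (minn JN (N - JN)))./2.

(* For N even and J0, JN odd in [3, N - 3], all truncated subtractions are
   genuine ones and the halving is exact. *)
Definition L0 : nat :=
  (maxn (maxn (J0 - 1) (N - 1 - JN)) (N + JN - J0))./2.

Definition num_copies : nat := 6 + N %/ rho.+1.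

End Model.

(* Main.v *)
Require Import Defs.
From HB Require Import structures.
From mathcomp Require Import all_boot all_order all_algebra.
From mathcomp Require Import all_classical all_reals all_analysis measurable_realfun.
From mathcomp Require Import zify ring lra.

(** Why the theorem is true.

    Regard J0 as the left neighbour of 0 and JN as the right neighbour of N.
    At every step both walkers stay put (probability 1/2) or both move, and
    when they move they go either in the same direction, which keeps y - x
    (a parallel step), or in opposite directions, which keeps x + y (a mirror
    step).  The choice depends on x + y only: mirror steps on the four lines
    x + y = J0 - 1, N + JN + 1, J0 + JN - N, N + J0 + JN, parallel steps
    elsewhere.

    On the line x + y = J0 - 1 the pair coalesces at both ends: the walkers
    meet in the middle, or X is at 0 with Y at J0 - 1, and the next outward
    step sends both to J0.  So the time spent there is the exit time of a lazy
    walk from (J0 - 1)/2 positions.  The line x + y = N + JN + 1 is its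
    reflection, with (N - 1 - JN)/2 positions.  A pair with small y - x and
    with x + y between these two lines is carried by parallel steps to one of
    them, and (x + y)/2 runs through (N + JN - J0)/2 positions.  These are the
    three lengths of which L0 is the maximum.

    The other pairs are brought into this good situation in a bounded number
    of phases of the same kind.  Let k = J0 + JN - N be nonnegative (the other
    case is its reflection).  The danger is a close pair with x + y < k: when
    X is sent from 0 to J0, the pair becomes so wide that its right end reaches
    N before x + y reaches N + JN + 1.  Then N is left for JN, and this lowers
    the distance by N - JN + 1 >= rho + 2, so at most N / (rho + 1) such phases
    occur.  They leave the pair above the line x + y = k, and mirror steps on
    this line prevent a return: from there the walkers meet, or leave from
    (0, k) to (J0, k + 1), which is a good pair.

    Hence every pair has a rank (the number of phases still to come) and a
    position in {1, ..., L0}, and each move either coalesces the pair, lowers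
    the rank, or changes the position by one (ladder_exists).  A lazy walk
    leaves the strip {1, ..., L0} most slowly from its middle
    (delay_middle_le), so an induction on time bounds P(tau <= t) from below
    by the distribution function of a sum of exit times
    (meet_ge_exit_sum_cdf).

    It remains to identify both sides.  The chain of pairs is driven by the
    base-4 digits of a uniform point of [0, 1] (driven_markov); the tail of
    the coupling time and the law of the exit time both follow from a formula
    for the probability that a chain stays in a finite set (survival); and
    the law of an independent sum of times is computed by adding one summand
    at a time (sum_event_le). *)

Set Implicit Arguments.
Unset Strict Implicit.
Unset Printing Implicit Defensive.

Import Order.TTheory GRing.Theory Num.Theory.

(** * Two coordinated walkers and their rungs *)

(** The neighbour of x on the right (b = true) or on the left, where the
    redistribution jumps count as moves to the missing neighbours of 0 and N. *)
Definition neighbor (N J0 JN : nat) (b : bool) (x : nat) : nat :=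
  if b then (if x == N then JN else x.+1) else (if x == 0 then J0 else x.-1).

Arguments neighbor : simpl never.

(** The first two lines end in coalescence on both sides; one of the last two,
    depending on the sign of J0 + JN - N, keeps close pairs away from the end
    from which a jump would leave them too wide.  Subtraction is avoided by
    writing x + y = J0 + JN - N additively. *)
Definition mirrored (N J0 JN x y : nat) : bool :=
  (x != y) && [|| x + y == J0.-1, x + y == N + JN + 1,
                  x + y + N == J0 + JN | x + y == N + (J0 + JN)].

Definition partner_dir (N J0 JN : nat) (b : bool) (x y : nat) : bool :=
  mirrored N J0 JN x y (+) b.

(** Here level x y r i reads: the pair x < y has r phases to go and is at
    position i of its current phase.  Since the walkers may overtake each other
    in a jump, the new pair is allowed to be in either order. *)
Definition progress (level : nat -> nat -> nat -> nat -> Prop) (r i x y : nat) : Prop :=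
  x = y \/ exists r' i', (level x y r' i' \/ level y x r' i') /\
    (r' < r \/ r' = r /\ i' = i).

Lemma progress_sym level r i x y : progress level r i x y -> progress level r i y x.
Proof.
case=> [->|[r' [i' [h e]]]]; first by left.
by right; exists r', i'; split=> //; case: h; [right|left].
Qed.

(** The two moves of the pair lower, respectively raise, the position by one,
    unless they end the phase; which direction of X lowers it depends on the
    phase. *)
Definition advances (N J0 JN : nat) (level : nat -> nat -> nat -> nat -> Prop)
    (r i x y : nat) : Prop :=
  exists b,
     progress level r i.-1 (neighbor N J0 JN b x)
       (neighbor N J0 JN (partner_dir N J0 JN b x y) y)
  /\ progress level r i.+1 (neighbor N J0 JN (~~ b) x)
       (neighbor N J0 JN (partner_dir N J0 JN (~~ b) x y) y).

(** What the comparison with a sum of exit times from {1, ..., L} needs. *)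
Definition ladder (N J0 JN L : nat) (level : nat -> nat -> nat -> nat -> Prop) : Prop :=
  forall x y r i, level x y r i ->
   [/\ 0 < r, 0 < i <= L, x < y <= N &
    advances N J0 JN level r i x y].

(** The phases, with a = N - JN, k = J0 + JN - N and c = N - J0, so that the two
    coalescence lines are x + y = a + k - 1 and x + y = a + 2k + 2c + 1; the line
    x + y = k is called the gate.  On a line of mirror steps the position is half
    the distance; elsewhere it is half the difference between x + y and a
    neighbouring line.  RungMidFar are the pairs too wide to reach the upper
    line: Y reaches N first, and each such visit reduces the distance by a + 1,
    which the quotient q counts.  The bounds on y - x in RungAboveGate and
    RungTop are those under which the next jump leads between the two
    coalescence lines, or onto one of them. *)
Inductive rung (a k c x y : nat) : nat -> nat -> Prop :=
| RungLow i of x + y = a + k - 1 & y = x + i.*2 : rung a k c x y 1 i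
| RungHigh i of x + y = a + k.*2 + c.*2 + 1 & y = x + i.*2 : rung a k c x y 1 i
| RungMidNear i of a + k - 1 < x + y < a + k.*2 + c.*2 + 1 & y - x <= a - 1
   & x + y = a + k - 1 + i.*2 : rung a k c x y 2 i
| RungMidFar i q of a + k - 1 < x + y < a + k.*2 + c.*2 + 1 & a < y - x < a + k
   & x + y = a + k - 1 + i.*2 & q * a.+1 <= y - x < q.+1 * a.+1 : rung a k c x y (4 + q) i
| RungGate i of x + y = k & y = x + i.*2 : rung a k c x y 3 i
| RungAboveGate i of k < x + y < a + k - 1 & y - x <= k + c.*2 + 2
   & x + y = k + i.*2 : rung a k c x y 4 i
| RungBelowGate i of x + y < k & x + y + i.*2 = k : rung a k c x y (5 + (a + k - 1) %/ a.+1) i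
| RungTop i of a + k.*2 + c.*2 + 1 < x + y & y - x <= k + c.*2 + 2
   & x + y = a + k.*2 + c.*2 + 1 + i.*2 : rung a k c x y 3 i.

Definition on_rung a k c x y r i : Prop :=
  [/\ x < y <= a + k + c, ~~ odd (x + y) & rung a k c x y r i].

Section Rungs.
(** The case J0 + JN >= N, parametrized by a = N - JN, k = J0 + JN - N and
    c = N - J0. *)
Variables a k c : nat.
Hypotheses (ha : odd a) (hk : ~~ odd k) (hc : odd c) (a3 : 2 < a) (c3 : 2 < c).
Let N := a + k + c.
Let J0 := a + k.
Let JN := k + c.
Let L := (maxn (a + k - 1) (k + c.*2))./2.

(** A distance at most rho is less than both a and c, and then no constraint in
    the definition of the phases is violated. *)
Lemma on_rung_start x y :
  x < y <= a + k + c -> ~~ odd (x + y) -> y - x < a -> y - x < c ->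
  exists r i, on_rung a k c x y r i /\ r <= 5 + (a + k - 1) %/ a.+1.
Proof.
move=> xy od Da Dc.
have [s1|s1|s1] := ltngtP (x + y) k.
- exists (5 + (a + k - 1) %/ a.+1), (k - (x + y))./2; split=> //.
  split=> //; apply: RungBelowGate => //; lia.
- have [s2|s2|s2] := ltngtP (x + y) (a + k - 1).
  + exists 4, (x + y - k)./2; split; last lia.
    split=> //; apply: RungAboveGate; lia.
  + have [s3|s3|s3] := ltngtP (x + y) (a + k.*2 + c.*2 + 1).
    * exists 2, (x + y - (a + k - 1))./2; split; last lia.
      split=> //; apply: RungMidNear; lia.
    * exists 3, (x + y - (a + k.*2 + c.*2 + 1))./2; split; last lia.
      split=> //; apply: RungTop; lia.
    * exists 1, (y - x)./2; split; last lia.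
      split=> //; apply: RungHigh; lia.
  + exists 1, (y - x)./2; split; last lia.
    split=> //; apply: RungLow; lia.
- exists 3, (y - x)./2; split; last lia.
  split=> //; apply: RungGate; lia.
Qed.

Lemma neighbor_interior b x : 0 < x < N -> neighbor N J0 JN b x = if b then x.+1 else x.-1.
Proof. by rewrite /neighbor; case: b; case: eqP; lia. Qed.

Lemma neighbor_right_end : neighbor N J0 JN true N = JN.
Proof. by rewrite /neighbor eqxx. Qed.

(** Where a jump from below the gate leads. *)
Lemma progress_far r i x y : 4 + (y - x) %/ a.+1 < r -> y <= N -> ~~ odd (x + y) ->
  a + k - 1 < x + y < a + k.*2 + c.*2 + 1 -> a < y - x < a + k ->
  progress (on_rung a k c) r i x y.
Proof.
move=> r4 yN od s d; right.
exists (4 + (y - x) %/ a.+1), (x + y - (a + k - 1))./2; split; last by left.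
left; split=> //; first lia.
by apply: RungMidFar; lia.
Qed.

(** Where the jumps that produce a narrow pair lead; the three cases are the two
    coalescence lines and the region between them. *)
Lemma progress_near r i x y : 2 < r -> x <= y <= N -> ~~ odd (x + y) ->
  a + k - 1 <= x + y <= a + k.*2 + c.*2 + 1 -> y - x < a ->
  progress (on_rung a k c) r i x y.
Proof.
move=> r2 xy od s d.
have [->|nxy] := eqVneq x y; first by left.
right; have [s2|s2|s2] := ltngtP (x + y) (a + k - 1); first lia.
  have [s3|s3|s3] := ltngtP (x + y) (a + k.*2 + c.*2 + 1); last 1 first.
  - exists 1, (y - x)./2; split; last lia.
    by left; split=> //; first lia; apply: RungHigh; lia.
  - exists 2, (x + y - (a + k - 1))./2; split; last lia.
    by left; split=> //; first lia; apply: RungMidNear; lia.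
  - lia.
exists 1, (y - x)./2; split; last lia.
by left; split=> //; first lia; apply: RungLow; lia.
Qed.

Lemma progress_on_rung r i x y r' i' :
  on_rung a k c x y r' i' -> r' < r \/ r' = r /\ i' = i ->
  progress (on_rung a k c) r i x y.
Proof. by move=> h e; right; exists r', i'; split=> //; left. Qed.

Lemma progress_same_rank r x y i : on_rung a k c x y r i -> progress (on_rung a k c) r i x y.
Proof. by move=> h; apply: progress_on_rung h _; right. Qed.

Lemma mirroredE x y : x < y -> y <= N ->
  mirrored N J0 JN x y = [|| x + y == a + k - 1, x + y == a + k.*2 + c.*2 + 1 | x + y == k].
Proof.
rewrite /mirrored /N /J0 /JN => xy yN.
by apply/idP/idP; lia.
Qed.

Lemma partner_dir_parallel b x y : ~~ mirrored N J0 JN x y -> partner_dir N J0 JN b x y = b.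
Proof. by rewrite /partner_dir => /negPf->. Qed.

Lemma partner_dir_mirror b x y : mirrored N J0 JN x y -> partner_dir N J0 JN b x y = ~~ b.
Proof. by rewrite /partner_dir => ->. Qed.

(** Away from 0 and N a mirror step changes half the distance by one, so it
    stays on the line unless the walkers meet. *)
Lemma advances_mirror r i x y :
  0 < i -> 0 < x -> y < N -> ~~ odd (x + y) -> y = x + i.*2 -> mirrored N J0 JN x y ->
  (forall x' y' j, x' < y' <= N -> x' + y' = x + y -> y' = x' + j.*2 -> rung a k c x' y' r j) ->
  advances N J0 JN (on_rung a k c) r i x y.
Proof.
move=> i0 x0 yN od yE mir R; exists true.
rewrite !partner_dir_mirror // !neighbor_interior /=; try lia; split.
- have [ix|ix] := eqVneq i 1; first by left; lia.
  by right; exists r, i.-1; split; [left; split; [lia|lia|apply: R; lia]|right].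
- right; exists r, i.+1; split; [left; split; [lia|lia|apply: R; lia]|by right].
Qed.

(** At the end of the line, X = 0 and Y = J0 - 1, and the outward step sends
    both to J0. *)
Lemma advances_low i x y : x < y <= N -> ~~ odd (x + y) -> x + y = a + k - 1 -> y = x + i.*2 ->
  advances N J0 JN (on_rung a k c) 1 i x y.
Proof.
move=> xy od s yE.
have mir : mirrored N J0 JN x y by rewrite mirroredE ?s ?eqxx; lia.
have [x0|x0] := posnP x; last first.
  apply: advances_mirror; rewrite // ?/N; try lia.
  by move=> *; apply: RungLow; lia.
exists true; rewrite !partner_dir_mirror //= !(@neighbor_interior _ y) ?/N; try lia.
have -> : neighbor N J0 JN true x = x.+1 by rewrite /neighbor /N; case: eqP; lia.
have -> : neighbor N J0 JN false x = J0 by rewrite x0.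
split; last by left; rewrite /J0; lia.
have [ix|ix] := eqVneq i 1; first by left; lia.
apply: progress_same_rank.
by split; rewrite /=; try lia; apply: RungLow; lia.
Qed.

Lemma advances_high i x y : x < y <= N -> ~~ odd (x + y) ->
  x + y = a + k.*2 + c.*2 + 1 -> y = x + i.*2 ->
  advances N J0 JN (on_rung a k c) 1 i x y.
Proof.
move=> xy od s yE.
have mir : mirrored N J0 JN x y by rewrite mirroredE ?s ?eqxx ?orbT; lia.
have [yN|yN] := eqVneq y N; last first.
  apply: advances_mirror; rewrite // ?/N; try lia.
  by move=> *; apply: RungHigh; lia.
exists true; rewrite !partner_dir_mirror //= !(@neighbor_interior _ x) ?/N; try lia.
have -> : neighbor (a + k + c) J0 JN false y = y.-1 by rewrite /neighbor; case: eqP; lia.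
have -> : neighbor (a + k + c) J0 JN true y = JN by rewrite yN neighbor_right_end.
split; last by left; rewrite /JN; lia.
have [ix|ix] := eqVneq i 1; first by left; lia.
apply: progress_same_rank.
by split; rewrite /=; try lia; apply: RungHigh; lia.
Qed.

(** At the end of the line, X = 0 and Y = k, and the outward step leads to
    (J0, k + 1), at distance a - 1: just narrow enough to be carried to either
    coalescence line. *)
Lemma advances_gate i x y : x < y <= N -> ~~ odd (x + y) ->
  x + y = k -> y = x + i.*2 ->
  advances N J0 JN (on_rung a k c) 3 i x y.
Proof.
move=> xy od s yE.
have mir : mirrored N J0 JN x y by rewrite mirroredE ?s ?eqxx ?orbT; lia.
have [x0|x0] := posnP x; last first.
  apply: advances_mirror; rewrite // ?/N; try lia.
  by move=> *; apply: RungGate; lia.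
exists true; rewrite !partner_dir_mirror //= !(@neighbor_interior _ y) ?/N; try lia.
have -> : neighbor N J0 JN true x = x.+1 by rewrite /neighbor /N; case: eqP; lia.
have -> : neighbor N J0 JN false x = J0 by rewrite x0.
split; last first.
  by apply/progress_sym/progress_near; rewrite /J0 /N; lia.
have [ix|ix] := eqVneq i 1; first by left; lia.
apply: progress_same_rank.
by split; rewrite /=; try lia; apply: RungGate; lia.
Qed.

Lemma advances_parallel r i x y : 0 < x -> y < N -> x < y -> ~~ mirrored N J0 JN x y ->
  progress (on_rung a k c) r i.-1 x.-1 y.-1 -> progress (on_rung a k c) r i.+1 x.+1 y.+1 ->
  advances N J0 JN (on_rung a k c) r i x y.
Proof.
move=> x0 yN xy nm p1 p2; exists false.
rewrite !partner_dir_parallel // !neighbor_interior; try lia; by split.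
Qed.

(** Neither 0 nor N is reached before the coalescence lines, since the distance
    is less than a. *)
Lemma advances_near i x y : x < y <= N -> ~~ odd (x + y) ->
  a + k - 1 < x + y < a + k.*2 + c.*2 + 1 -> y - x <= a - 1 -> x + y = a + k - 1 + i.*2 ->
  advances N J0 JN (on_rung a k c) 2 i x y.
Proof.
move=> xy od s d iE.
have nm : ~~ mirrored N J0 JN x y by rewrite mirroredE; lia.
apply: advances_parallel; rewrite ?/N //; try lia.
- have [ix|ix] := eqVneq i 1.
    apply: (@progress_on_rung _ _ _ _ 1 (y - x)./2); last by left.
    by split; try lia; apply: RungLow; lia.
  apply: progress_same_rank; split; try lia.
  by apply: RungMidNear; lia.
- have [ix|ix] := eqVneq (x + y).+2 (a + k.*2 + c.*2 + 1).
    apply: (@progress_on_rung _ _ _ _ 1 (y - x)./2); last by left.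
    by split; try lia; apply: RungHigh; lia.
  apply: progress_same_rank; split; try lia.
  by apply: RungMidNear; lia.
Qed.

(** When Y = N, the outward step sends Y to JN and X one step to the right.  The
    distance decreases by a + 1, and x + y stays above k, so that the pair is
    never again below the gate. *)
Lemma advances_far i q x y : x < y <= N -> ~~ odd (x + y) ->
  a + k - 1 < x + y < a + k.*2 + c.*2 + 1 -> a < y - x < a + k -> x + y = a + k - 1 + i.*2 ->
  q * a.+1 <= y - x < q.+1 * a.+1 ->
  advances N J0 JN (on_rung a k c) (4 + q) i x y.
Proof.
move=> xy od s d iE qE.
have nm : ~~ mirrored N J0 JN x y by rewrite mirroredE; lia.
have down : progress (on_rung a k c) (4 + q) i.-1 x.-1 y.-1.
  have [ix|ix] := eqVneq i 1.
    apply: (@progress_on_rung _ _ _ _ 1 (y - x)./2); last by left.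
    by split; try lia; apply: RungLow; lia.
  apply: progress_same_rank; split; try lia.
  by apply: RungMidFar; lia.
have [yN|yN] := eqVneq y N; last first.
  apply: advances_parallel; rewrite // ?/N //; try lia.
  apply: progress_same_rank; split; try lia.
  by apply: RungMidFar; lia.
exists false; rewrite !partner_dir_parallel // !(@neighbor_interior _ x) ?/N; try lia.
have -> : neighbor (a + k + c) J0 JN false y = y.-1 by rewrite /neighbor; case: eqP; lia.
have -> : neighbor (a + k + c) J0 JN true y = JN by rewrite yN neighbor_right_end.
split=> //=.
have q0 : 0 < q by rewrite lt0n; apply/eqP => q0; rewrite q0 in qE; lia.
have [s2|s2] := leqP (a + k - 1) (x.+1 + JN); last first.
  have [e|e] := eqVneq x.+1 JN; first by left.
  apply: (@progress_on_rung _ _ _ _ 4 (x.+1 + JN - k)./2); last by left; lia.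
  by split; rewrite /JN in s2 e *; try lia; apply: RungAboveGate; lia.
have [d2|d2] := ltnP (JN - x.+1) a.
  by apply: progress_near; rewrite /JN in s2 d2 *; lia.
have [s3|s3] := eqVneq (a + k - 1) (x.+1 + JN).
  apply: (@progress_on_rung _ _ _ _ 1 (JN - x.+1)./2); last by left; lia.
  by split; rewrite /JN in s2 s3 d2 *; try lia; apply: RungLow; lia.
apply: (@progress_on_rung _ _ _ _ (4 + q.-1) (x.+1 + JN - (a + k - 1))./2); last by left; lia.
split; rewrite /JN in s2 s3 d2 *; try lia; apply: RungMidFar; try lia.
rewrite -(ltn_predK q0) !mulSn /= in qE *; lia.
Qed.

(** The end X = 0 is reached before the gate only if the distance exceeds k;
    the jump then leads to a pair at distance less than a. *)
Lemma advances_above_gate i x y : x < y <= N -> ~~ odd (x + y) ->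
  k < x + y < a + k - 1 -> y - x <= k + c.*2 + 2 -> x + y = k + i.*2 ->
  advances N J0 JN (on_rung a k c) 4 i x y.
Proof.
move=> xy od s d iE.
have nm : ~~ mirrored N J0 JN x y by rewrite mirroredE; lia.
have up : progress (on_rung a k c) 4 i.+1 x.+1 y.+1.
  have [ix|ix] := eqVneq (x + y).+2 (a + k - 1).
    apply: (@progress_on_rung _ _ _ _ 1 (y - x)./2); last by left.
    by split; try lia; apply: RungLow; lia.
  apply: progress_same_rank; split; try lia.
  by apply: RungAboveGate; lia.
have [x0|x0] := posnP x; last first.
  apply: advances_parallel; rewrite // ?/N //; try lia.
  have [ix|ix] := eqVneq i 1.
    apply: (@progress_on_rung _ _ _ _ 3 (y - x)./2); last by left.
    by split; try lia; apply: RungGate; lia.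
  apply: progress_same_rank; split; try lia.
  by apply: RungAboveGate; lia.
exists false; rewrite !partner_dir_parallel // !(@neighbor_interior _ y) ?/N; try lia.
have -> : neighbor N J0 JN true x = x.+1 by rewrite /neighbor /N; case: eqP; lia.
have -> : neighbor N J0 JN false x = J0 by rewrite x0.
split=> //=.
by apply/progress_sym/progress_near; rewrite /J0 /N; lia.
Qed.

(** At Y = N the jump sends the pair between the coalescence lines or onto one,
    at distance a + 1 - (y - x). *)
Lemma advances_top i x y : x < y <= N -> ~~ odd (x + y) ->
  a + k.*2 + c.*2 + 1 < x + y -> y - x <= k + c.*2 + 2 ->
  x + y = a + k.*2 + c.*2 + 1 + i.*2 ->
  advances N J0 JN (on_rung a k c) 3 i x y.
Proof.
move=> xy od s d iE.
have nm : ~~ mirrored N J0 JN x y by rewrite mirroredE; lia.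
have down : progress (on_rung a k c) 3 i.-1 x.-1 y.-1.
  have [ix|ix] := eqVneq i 1.
    apply: (@progress_on_rung _ _ _ _ 1 (y - x)./2); last by left.
    by split; try lia; apply: RungHigh; lia.
  apply: progress_same_rank; split; try lia.
  by apply: RungTop; lia.
have [yN|yN] := eqVneq y N; last first.
  apply: advances_parallel; rewrite // ?/N //; try lia.
  apply: progress_same_rank; split; try lia.
  by apply: RungTop; lia.
exists false; rewrite !partner_dir_parallel // !(@neighbor_interior _ x) ?/N; try lia.
have -> : neighbor (a + k + c) J0 JN false y = y.-1 by rewrite /neighbor; case: eqP; lia.
have -> : neighbor (a + k + c) J0 JN true y = JN by rewrite yN neighbor_right_end.
split=> //=.
by apply/progress_sym/progress_near; rewrite /JN /N; lia.
Qed.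

(** At X = 0 the distance d is less than k, so the jump produces the distance
    a + k - d + 1 > a, with x + y still below the upper line. *)
Lemma advances_below_gate i x y : x < y <= N -> ~~ odd (x + y) ->
  x + y < k -> x + y + i.*2 = k ->
  let r := 5 + (a + k - 1) %/ a.+1 in
  advances N J0 JN (on_rung a k c) r i x y.
Proof.
move=> xy od s iE r.
have nm : ~~ mirrored N J0 JN x y by rewrite mirroredE; lia.
have up : progress (on_rung a k c) r i.-1 x.+1 y.+1.
  have [ix|ix] := eqVneq i 1.
    apply: (@progress_on_rung _ _ _ _ 3 (y - x)./2); last by left; rewrite /r; lia.
    by split; try lia; apply: RungGate; lia.
  apply: progress_same_rank; split; try lia.
  by apply: RungBelowGate; lia.
exists true; rewrite !partner_dir_parallel // !(@neighbor_interior _ y) ?/N; try lia.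
have -> : neighbor (a + k + c) J0 JN true x = x.+1 by rewrite /neighbor; case: eqP; lia.
split=> //=.
have [x0|x0] := posnP x; last first.
  rewrite neighbor_interior ?/N; last lia.
  apply: progress_same_rank; split; try lia.
  by apply: RungBelowGate; lia.
have -> : neighbor (a + k + c) J0 JN false x = J0 by rewrite x0.
apply/progress_sym/progress_far; rewrite /J0 /N; try lia.
apply: (@leq_ltn_trans (4 + (a + k - 1) %/ a.+1)); last by rewrite /r; lia.
by rewrite leq_add2l leq_div2r //; lia.
Qed.

Lemma ladder_on_rung : ladder N J0 JN L (on_rung a k c).
Proof.
move=> x y r i [xy od rg]; split.
- by case: rg.
- by case: rg => *; rewrite /L; lia.
- by rewrite xy.
case: rg.
- by move=> *; apply: advances_low.
- by move=> *; apply: advances_high.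
- by move=> *; apply: advances_near.
- by move=> *; apply: advances_far.
- by move=> *; apply: advances_gate.
- by move=> *; apply: advances_above_gate.
- by move=> *; apply: advances_below_gate.
- by move=> *; apply: advances_top.
Qed.
End Rungs.

Lemma mirroredC N J0 JN x y : mirrored N J0 JN x y = mirrored N J0 JN y x.
Proof. by rewrite /mirrored eq_sym addnC. Qed.

Lemma neighbor_le N J0 JN b x : J0 <= N -> JN <= N -> x <= N -> neighbor N J0 JN b x <= N.
Proof. by rewrite /neighbor; case: b; case: eqP; lia. Qed.

Lemma neighbor_reflect N J0 JN b x : J0 <= N -> JN <= N -> x <= N ->
  neighbor N (N - JN) (N - J0) b (N - x) = N - neighbor N J0 JN (~~ b) x.
Proof. by rewrite /neighbor; case: b => /=; case: eqP; case: eqP; lia. Qed.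

Lemma mirrored_reflect N J0 JN x y : 0 < J0 <= N -> JN < N -> x <= N -> y <= N ->
  mirrored N (N - JN) (N - J0) (N - x) (N - y) = mirrored N J0 JN x y.
Proof. by rewrite /mirrored => *; apply/idP/idP; lia. Qed.

(** The reflection x -> N - x exchanges J0 with N - JN and JN with N - J0, swaps
    left and right, and permutes the four mirror lines. *)
Lemma ladder_reflect N J0 JN L C : 0 < J0 <= N -> JN < N ->
  ladder N (N - JN) (N - J0) L C ->
  ladder N J0 JN L (fun x y r i => [/\ x <= N, y <= N & C (N - y) (N - x) r i]).
Proof.
move=> h0 hN lad x y r i [xN yN Cxy].
have [r0 iL xy [b []]] := lad _ _ _ _ Cxy.
have prg j b' :
  progress C r j (neighbor N (N - JN) (N - J0) b' (N - y))
    (neighbor N (N - JN) (N - J0) (partner_dir N (N - JN) (N - J0) b' (N - y) (N - x)) (N - x)) ->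
  progress (fun x y r i => [/\ x <= N, y <= N & C (N - y) (N - x) r i]) r j
    (neighbor N J0 JN (~~ partner_dir N J0 JN b' x y) x)
    (neighbor N J0 JN (partner_dir N J0 JN (~~ partner_dir N J0 JN b' x y) x y) y).
  rewrite /partner_dir mirrored_reflect // (mirroredC _ _ _ y x).
  set m := mirrored _ _ _ _ _.
  have -> : m (+) ~~ (m (+) b') = ~~ b' by case: m b' => [] [].
  rewrite !neighbor_reflect; try lia.
  set x' := neighbor _ _ _ _ x; set y' := neighbor _ _ _ _ y.
  have x'N : x' <= N by apply: neighbor_le; lia.
  have y'N : y' <= N by apply: neighbor_le; lia.
  case=> [|[r' [i' [h e]]]]; [by left; lia|right; exists r', i'].
  by split=> //; case: h; [left|right].
move=> /prg p1 /prg p2; split=> //; first lia.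
(* The reflected first walker is the second one, so the direction given is
   that of the partner. *)
exists (~~ partner_dir N J0 JN b x y); split=> //.
by move: p2; rewrite /partner_dir; case: mirrored; case: (b).
Qed.

(** The number of wide phases is at most (a + k - 1) / (a + 1), which is bounded
    by N / (rho + 1) because rho <= a. *)
Lemma ladder_exists N J0 JN : ~~ odd N -> odd J0 -> odd JN ->
  3 <= J0 <= N - 3 -> 3 <= JN <= N - 3 ->
  exists C, ladder N J0 JN (L0 N J0 JN) C /\
   forall x y, x < y <= N -> ~~ odd (y - x) -> y - x <= rho N J0 JN ->
    exists r i, C x y r i /\ r <= num_copies N J0 JN.
Proof.
move=> eN o0 oN h0 hN; rewrite /L0 /num_copies /rho.
set q := minn _ _; set p := 2 * _.
have : p <= q by rewrite /p mul2n -{2}(odd_double_half q) leq_addl.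
rewrite {1}/q !leq_min => /andP[/andP[p1 p2] /andP[p3 p4]].
clearbody p; clear q.
have [k0|k0] := leqP N (J0 + JN).
- have [a aE] : exists a, a = N - JN by eexists.
  have [k kE] : exists k, k = J0 + JN - N by eexists.
  have [c cE] : exists c, c = N - J0 by eexists.
  have NE : N = a + k + c by lia.
  have J0E : J0 = a + k by lia.
  have JNE : JN = k + c by lia.
  exists (on_rung a k c); split.
    have -> : (maxn (maxn (J0 - 1) (N - 1 - JN)) (N + JN - J0))./2
      = (maxn (a + k - 1) (k + c.*2))./2.
      congr _./2; congr maxn; last lia.
      by rewrite (maxn_idPl _); lia.
    by rewrite NE J0E JNE; apply: ladder_on_rung; lia.
  move=> x y xy od d.
  have [|||||||||r [i [h rb]]] := @on_rung_start a k c _ _ _ _ _ x y; try lia.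
  exists r, i; split=> //.
  have : (a + k - 1) %/ a.+1 <= N %/ p.+1.
    apply: (@leq_trans ((a + k - 1) %/ p.+1)); first by apply: leq_div2l => //; lia.
    by apply: leq_div2r; lia.
  by lia.
- have [a aE] : exists a, a = J0 by eexists.
  have [k kE] : exists k, k = N - (J0 + JN) by eexists.
  have [c cE] : exists c, c = JN by eexists.
  have NE : N = a + k + c by lia.
  have J0E : N - JN = a + k by lia.
  have JNE : N - J0 = k + c by lia.
  exists (fun x y r i => [/\ x <= N, y <= N & on_rung a k c (N - y) (N - x) r i]); split.
    have -> : (maxn (maxn (J0 - 1) (N - 1 - JN)) (N + JN - J0))./2
      = (maxn (a + k - 1) (k + c.*2))./2.
      congr _./2; congr maxn; last lia.
      by rewrite (maxn_idPr _); lia.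
    apply: ladder_reflect; try lia.
    by rewrite J0E JNE {1}NE; apply: ladder_on_rung; lia.
  move=> x y xy od d.
  have [|||||||||r [i [h rb]]] := @on_rung_start a k c _ _ _ _ _ (N - y) (N - x); try lia.
  exists r, i; split; first by split=> //; lia.
  have : (a + k - 1) %/ a.+1 <= N %/ p.+1.
    apply: (@leq_trans ((a + k - 1) %/ p.+1)); first by apply: leq_div2l => //; lia.
    by apply: leq_div2r; lia.
  by lia.
Qed.

(** * Sums of exit times of the lazy walk *)

Local Open Scope classical_set_scope.
Local Open Scope ring_scope.

Section Delay.
Variables (R : realFieldType) (L : nat).
Implicit Types (F : nat -> R) (t i : nat).

(** If F is the distribution function of a time S, then delay F t i is
    P(T + S <= t), where T is the exit time from {1, ..., L} of a lazy walk
    started at i, independent of S. *)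
Fixpoint delay F t i : R :=
  if (0 < i <= L)%N then
    if t is t'.+1 then 2^-1 * delay F t' i + 4^-1 * (delay F t' i.-1 + delay F t' i.+1)
    else 0
  else F t.

Lemma delay_out F t i : ~~ (0 < i <= L)%N -> delay F t i = F t.
Proof. by case: t => [|t] /= /negPf->. Qed.

Lemma delay_in0 F i : (0 < i <= L)%N -> delay F 0 i = 0.
Proof. by move=> /= ->. Qed.

Lemma delay_inS F t i : (0 < i <= L)%N ->
  delay F t.+1 i = 2^-1 * delay F t i + 4^-1 * (delay F t i.-1 + delay F t i.+1).
Proof. by move=> /= ->. Qed.

Arguments delay : simpl never.

Lemma delay_ge0 F t i : (forall t, 0 <= F t) -> 0 <= delay F t i.
Proof.
move=> F0; elim: t i => [|t IH] i; have [iL|iL] := boolP (0 < i <= L)%N.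
- by rewrite delay_in0.
- by rewrite delay_out.
- by rewrite delay_inS //; have := IH i; have := IH i.-1; have := IH i.+1; lra.
- by rewrite delay_out.
Qed.

Section Monotone.
Variable F : nat -> R.
Hypothesis F0 : forall t, 0 <= F t.
Hypothesis Fmono : forall t, F t <= F t.+1.

Lemma delay_nondecreasing t i : delay F t i <= delay F t.+1 i.
Proof.
elim: t i => [|t IH] i; have [iL|iL] := boolP (0 < i <= L)%N.
- by rewrite delay_in0 // delay_ge0.
- by rewrite !delay_out.
- rewrite (delay_inS F t) // (delay_inS F t.+1) //.
  by have := IH i; have := IH i.-1; have := IH i.+1; lra.
- by rewrite !delay_out.
Qed.

(** T + S >= S. *)
Lemma delay_le t i : delay F t i <= F t.
Proof.
elim: t i => [|t IH] i; have [iL|iL] := boolP (0 < i <= L)%N; rewrite ?(delay_out _ _ iL) //.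
  by rewrite delay_in0.
rewrite delay_inS //; apply: (le_trans _ (Fmono t)).
by have := IH i; have := IH i.-1; have := IH i.+1; lra.
Qed.

(** The strip {1, ..., L} is invariant under i -> L + 1 - i. *)
Lemma delay_sym t i : (i <= L.+1)%N -> delay F t (L.+1 - i) = delay F t i.
Proof.
elim: t i => [|t IH] i iL; have [h|h] := boolP (0 < i <= L)%N.
- by rewrite !delay_in0 //; lia.
- by rewrite !delay_out //; lia.
- rewrite !delay_inS //; last lia.
  have -> : (L.+1 - i).-1 = (L.+1 - i.+1)%N by lia.
  have -> : (L.+1 - i).+1 = (L.+1 - i.-1)%N by lia.
  by rewrite !IH; try lia; rewrite [delay F t i.+1 + _]addrC.
- by rewrite !delay_out //; lia.
Qed.

(** The exit is slower from points closer to the middle.  By induction on t: the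
    average of a symmetric profile that decreases towards the middle decreases
    towards the middle. *)
Lemma delay_toward_middle t i : (i.*2.+1 <= L.+1)%N -> delay F t i.+1 <= delay F t i.
Proof.
elim: t i => [|t IH] i iL; have [h|h] := boolP (0 < i <= L)%N;
  try by rewrite [leRHS]delay_out // delay_le.
  by rewrite !delay_in0 //; lia.
have [e|e] := eqVneq (i.*2.+1) L.+1.
  by have <- : (L.+1 - i)%N = i.+1 by [lia]; rewrite delay_sym //; lia.
rewrite !delay_inS //; last lia.
have h1 : delay F t i.+1 <= delay F t i by apply: IH; lia.
have h2 : delay F t i <= delay F t i.-1.
  by have := IH i.-1; rewrite prednK; last lia; apply; lia.
(* When i + 1 is the middle, i + 2 is the mirror image of i, and the rise from
   i + 1 to i + 2 is compensated by the fall from i to i + 1. *)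
rewrite /=; have [e2|e2] := eqVneq (i.*2.+2) L.+1.
  have <- : (L.+1 - i)%N = i.+2 by lia.
  by rewrite delay_sym; last lia; lra.
have h3 : delay F t i.+2 <= delay F t i.+1 by apply: IH; lia.
by lra.
Qed.

(** The middle of the strip is the slowest starting point. *)
Lemma delay_middle_le t i : (i <= L.+1)%N -> delay F t (L.+1)./2 <= delay F t i.
Proof.
have half j : (j <= (L.+1)./2)%N -> delay F t (L.+1)./2 <= delay F t j.
  move=> /subnKC; move: (_ - j)%N => n; elim: n j => [|n IH] j; first by rewrite addn0 => ->.
  rewrite addnS -addSn => jE; apply: le_trans (IH _ jE) _.
  by apply: delay_toward_middle; lia.
move=> iL; have [|iL2] := leqP i (L.+1)./2; first exact: half.
by rewrite -(delay_sym _ iL) half //; lia.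
Qed.

End Monotone.

(** The distribution function of a sum of r independent exit times of walks
    started in the middle. *)
Definition exit_sum_cdf (r : nat) : nat -> R :=
  iter r (fun F t => delay F t (L.+1)./2) (fun=> 1).

Lemma exit_sum_cdf_ge0 r t : 0 <= exit_sum_cdf r t.
Proof. by elim: r t => [|r IH] t //=; apply: delay_ge0. Qed.

Lemma exit_sum_cdf_nondecreasing r t : exit_sum_cdf r t <= exit_sum_cdf r t.+1.
Proof.
elim: r t => [|r IH] t //=; apply: delay_nondecreasing => //; exact: exit_sum_cdf_ge0.
Qed.

Lemma exit_sum_cdf_le r s t : (r <= s)%N -> exit_sum_cdf s t <= exit_sum_cdf r t.
Proof.
move/subnKC <-; elim: (s - r)%N => [|n IH]; first by rewrite addn0.
rewrite addnS; apply: le_trans IH => /=; apply: delay_le => //.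
  exact: exit_sum_cdf_ge0.
exact: exit_sum_cdf_nondecreasing.
Qed.

(** Delaying the time 0 recovers the exit time itself, so this is
    P(T = j) for the walk started at i. *)
Definition exit_pmf : nat -> nat -> R := delay (fun t => (t == 0)%:R).

(** Both sides satisfy the recursion that defines delay. *)
Lemma delay_convolution F t i :
  delay F t i = \sum_(j < t.+1) exit_pmf j i * F (t - j)%N.
Proof.
elim: t i => [|t IH] i; have [h|h] := boolP (0 < i <= L)%N.
- by rewrite big_ord1 /exit_pmf !delay_in0 // mul0r.
- by rewrite big_ord1 /exit_pmf !delay_out // mul1r.
- rewrite big_ord_recl /exit_pmf delay_in0 // mul0r add0r delay_inS // !IH.
  rewrite -big_split /= !mulr_sumr -big_split /=.
  apply: eq_bigr => j _; rewrite /bump add1n subSS delay_inS //.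
  by rewrite !mulrDl !mulrDr !mulrDl !mulrA.
- rewrite big_ord_recl /exit_pmf !delay_out // subn0 mul1r big1 ?addr0 // => j _.
  by rewrite delay_out // mul0r.
Qed.

(** P(T = j + 1) = P(T <= j + 1) - P(T <= j). *)
Lemma exit_pmfS j i : exit_pmf j.+1 i = delay (fun=> 1) j.+1 i - delay (fun=> 1) j i.
Proof.
rewrite /exit_pmf; elim: j i => [|j IH] i; have [h|h] := boolP (0 < i <= L)%N.
- rewrite !delay_inS // !(delay_in0 _ h).
  suff e k : delay (fun t => (t == 0)%:R) 0 k = delay (fun=> 1) 0 k :> R by rewrite !e; lra.
  by [].
- by rewrite !delay_out //= subrr.
- by rewrite [LHS]delay_inS // !IH [delay _ j.+2 i]delay_inS // (delay_inS _ j h); lra.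
- by rewrite !delay_out //= subrr.
Qed.

Lemma exit_pmf0 i : exit_pmf 0 i = delay (fun=> 1) 0 i.
Proof. by []. Qed.

(** By induction on t: the probability M of having met and the distribution
    function on the right are averaged over the same moves, and a move that
    ends a phase can only help, because T + S >= S and because the next phase
    starts at a position no slower than the middle. *)
Lemma meet_ge_exit_sum_cdf N J0 JN C (M : nat -> nat -> nat -> R) :
  (J0 <= N)%N -> (JN <= N)%N ->
  ladder N J0 JN L C ->
  (forall t x y, 0 <= M t x y) -> (forall t x, M t x x = 1) ->
  (forall t x y, (x <= N)%N -> (y <= N)%N -> x != y ->
     M t.+1 x y = 2^-1 * M t x y
      + 4^-1 * (M t (neighbor N J0 JN false x) (neighbor N J0 JN (partner_dir N J0 JN false x y) y)
      + M t (neighbor N J0 JN true x) (neighbor N J0 JN (partner_dir N J0 JN true x y) y))) ->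
  forall t x y r i, C x y r i \/ C y x r i -> delay (exit_sum_cdf r.-1) t i <= M t x y.
Proof.
move=> J0N JNN lad M0 M1 MS.
(* The rule is symmetric in the two walkers, so the order of the pair can be
   forgotten. *)
have lad_sym x y r i : C x y r i \/ C y x r i ->
  [/\ (0 < r)%N, (0 < i <= L)%N, [&& x != y, (x <= N)%N & (y <= N)%N] &
    advances N J0 JN C r i x y].
  case=> [/lad|/lad] [r0 i0 xy [b [p1 p2]]].
    by split=> //; [lia|exists b].
  split=> //; first lia.
  exists (partner_dir N J0 JN b y x); move: p1 p2; rewrite /partner_dir (mirroredC _ _ _ x y).
  set m := mirrored _ _ _ _ _ => p1 p2; split.
    have -> : m (+) (m (+) b) = b by case: m b {p1 p2} => [] [].
    exact: progress_sym.
  have -> : ~~ (m (+) b) = m (+) ~~ b by case: m b {p1 p2} => [] [].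
  have -> : m (+) (m (+) ~~ b) = ~~ b by case: m b {p1 p2} => [] [].
  exact: progress_sym.
elim=> [|t IH] x y r i Cxy; have [r0 iL xy [b [p1 p2]]] := lad_sym _ _ _ _ Cxy.
  by rewrite delay_in0.
have prg j x' y' : (j <= L.+1)%N -> progress C r j x' y' ->
    delay (exit_sum_cdf r.-1) t j <= M t x' y'.
  move=> jL [->|[r' [i' [h e]]]].
    rewrite M1; apply: (@le_trans _ _ (exit_sum_cdf r.-1 t)).
      by apply: delay_le; [exact: exit_sum_cdf_ge0|exact: exit_sum_cdf_nondecreasing].
    exact: (@exit_sum_cdf_le 0).
  case: e => [r'r|[<- <-]]; last exact: IH.
  apply: le_trans (IH _ _ _ _ h).
  have [r'0 i'L _ _] := lad_sym _ _ _ _ h.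
  apply: (@le_trans _ _ (exit_sum_cdf r' t)).
    apply: (@le_trans _ _ (exit_sum_cdf r.-1 t)); last by apply: exit_sum_cdf_le; lia.
    by apply: delay_le; [exact: exit_sum_cdf_ge0|exact: exit_sum_cdf_nondecreasing].
  rewrite -{1}(prednK r'0) /=; apply: delay_middle_le; last lia.
    exact: exit_sum_cdf_ge0.
  exact: exit_sum_cdf_nondecreasing.
have {p1} h1 := prg _ _ _ _ p1; have {p2} h2 := prg _ _ _ _ p2.
rewrite delay_inS // MS; try lia.
have {}h1 := h1 ltac:(lia); have {}h2 := h2 ltac:(lia).
have h3 := IH _ _ _ _ Cxy.
case: b h1 h2 => /=; lra.
Qed.
End Delay.

Arguments delay : simpl never.

(** * Survival of a Markov chain in a finite set *)

Section Survival.
Context (R : realType) (d : measure_display) (Omega : measurableType d).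
Context (P : probability Omega R) (S : eqType).
Implicit Types (W : nat -> Omega -> S) (A : seq S).

Definition stays W A n : set Omega := [set w | forall k, (k <= n)%N -> W k w \in A].

Lemma history_preimage W k n s : (k <= n)%N -> history W n (W k @^-1` [set s]).
Proof. by move=> kn; apply: sub_sigma_algebra; exists k, s. Qed.

Lemma history_preimage_seq W k n A : (k <= n)%N -> history W n [set w | W k w \in A].
Proof.
move=> kn.
suff : @measurable _
    (g_sigma_algebraType [set A | exists k s, (k <= n)%N /\ A = W k @^-1` [set s]])
    [set w | W k w \in A] by [].
elim: A => [|s A IH].
  rewrite [X in measurable X](_ : _ = set0); first exact: measurable0.
  by apply/seteqP; split.
rewrite [X in measurable X](_ : _ = W k @^-1` [set s] `|` [set w | W k w \in A]).
  by apply: measurableU => //; exact: history_preimage.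
apply/seteqP; split=> w /=; rewrite inE.
  by case/orP=> [/eqP|]; [left|right].
by case=> ->; rewrite ?eqxx ?orbT.
Qed.

Lemma history_stays W A n : history W n (stays W A n).
Proof.
suff : @measurable _
    (g_sigma_algebraType [set A | exists k s, (k <= n)%N /\ A = W k @^-1` [set s]])
    (stays W A n) by [].
rewrite (_ : stays W A n = \bigcap_(k in `I_n.+1) [set w | W k w \in A]); last by [].
apply: fin_bigcap_measurable => // k /= kn.
by apply: history_preimage_seq; rewrite -ltnS.
Qed.

Lemma measure_partition_seq (E : set Omega) (V : Omega -> S) A :
  uniq A -> measurable E -> (forall s, measurable (V @^-1` [set s])) ->
  E `<=` [set w | V w \in A] ->
  P E = (\sum_(s <- A) P (E `&` V @^-1` [set s]))%E.
Proof.
move=> uA mE mV; elim: A E uA mE => [|s A IH] E /= uA mE EA.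
  rewrite big_nil (_ : E = set0) ?measure0 //.
  by apply/seteqP; split=> // w /EA /=.
case/andP: uA => sA uA; rewrite big_cons.
have E1 : E = (E `&` V @^-1` [set s]) `|` (E `\` V @^-1` [set s]).
  by rewrite setUIDK.
rewrite {1}E1 measureU; first 1 last.
- exact: measurableI.
- exact: measurableD.
- by apply/seteqP; split=> // w /= [[_ ?] [_ ?]].
congr (_ + _)%E; rewrite [LHS](_ : _ = P (E `\` V @^-1` [set s])) //.
have mEs : measurable (E `\` V @^-1` [set s]) by exact: measurableD.
rewrite IH // => [|w /= [/EA /=]]; last by rewrite inE => /orP[/eqP|//].
apply: eq_big_seq => s' s'A; congr (P _).
apply/seteqP; split=> w /=; first by case=> [[]].
case=> Ew Vw; split=> //; split=> // Vs.
by move: sA; rewrite -Vs Vw s'A.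
Qed.

(** For a chain started in A, f t s is determined by the recursion as the
    probability of staying in A up to time t when starting from s. *)
Lemma survival p W A w0 (f : nat -> S -> R) n :
  uniq A -> w0 \in A -> (forall w, W 0%N w = w0) -> markov_chain P p W ->
  (forall s, s \in A -> f 0%N s = 1) ->
  (forall t s, s \in A -> f t.+1 s = \sum_(s' <- A) p s s' * f t s') ->
  P (stays W A n) = (f n w0)%:E.
Proof.
move=> uA w0A W0 [mF adF mkv] f0 fS.
have mW k s : measurable (W k @^-1` [set s]) by apply: (mF k); exact: adF.
have mM k : measurable (stays W A k) by apply: (mF k); exact: history_stays.
have staysS k s : s \in A ->
    stays W A k.+1 `&` W k.+1 @^-1` [set s] = stays W A k `&` W k.+1 @^-1` [set s].
  move=> sA; apply/seteqP; split=> w /= [Ww ws]; split=> // j.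
    by move=> jk; apply: Ww; exact: leqW.
  by rewrite leq_eqVlt => /orP[/eqP->|]; [rewrite ws|exact: Ww].
(* The conditional probability of staying for t more steps depends on W k
   only. *)
have main t k : P (stays W A (k + t)) =
    (\sum_(s <- A) P (stays W A k `&` W k @^-1` [set s]) * (f t s)%:E)%E.
  elim: t k => [|t IH] k.
    rewrite addn0 (@measure_partition_seq _ (W k) A) //; last by move=> w /(_ k); apply.
    apply: eq_big_seq => s sA.
    by rewrite f0 // mule1.
  rewrite addnS -addSn IH.
  transitivity (\sum_(s' <- A) \sum_(s <- A)
     P (stays W A k `&` W k @^-1` [set s]) * (p s s')%:E * (f t s')%:E)%E.
    apply: eq_big_seq => s' s'A.
    rewrite staysS // (@measure_partition_seq _ (W k) A) //; first 1 last.
    - exact: measurableI.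
    - by move=> w /= [/(_ k)]; rewrite leqnn => /(_ isT).
    rewrite ge0_sume_distrl //; apply: eq_bigr => s _.
    rewrite setIAC mkv //; exact: history_stays.
  rewrite exchange_big /=.
  apply: eq_big_seq => s sA.
  have fP : P (stays W A k `&` W k @^-1` [set s]) \is a fin_num.
    by apply: fin_num_measure; exact: measurableI.
  rewrite fS // -sumEFin -(fineK fP) fin_num_sume_distrr //.
  by apply: eq_bigr => s' _; rewrite EFinM muleA.
have W0E s : P (stays W A 0 `&` W 0%N @^-1` [set s]) = (s == w0)%:R%:E.
  have [->|sw] := eqVneq s w0.
    rewrite (_ : _ `&` _ = setT) ?probability_setT //.
    apply/seteqP; split=> // w _; split=> /=; last exact: W0.
    by move=> k; rewrite leqn0 => /eqP->; rewrite W0.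
  rewrite (_ : _ `&` _ = set0) ?measure0 //.
  by apply/seteqP; split=> // w /= [_]; rewrite W0 => e; rewrite e eqxx in sw.
have := main n 0%N; rewrite add0n => ->.
rewrite (bigD1_seq w0) //= W0E eqxx mul1e big1_seq ?adde0 // => s /andP[sw _].
by rewrite W0E (negPf sw) mul0e.
Qed.
End Survival.

(** * Law of the exit time *)

Section FirstTime.
Variable R : realType.
Implicit Type E : set nat.

Definition natural_times : set (\bar R) :=
  [set x | x = +oo%E \/ exists j : nat, x = j%:R%:E].

(** The infimum of a set of times is attained unless the set is empty. *)
Lemma first_time_dichotomy E :
  (E = set0 /\ first_time R E = +oo%E) \/
  exists n, [/\ E n, forall k, (k < n)%N -> ~ E k & first_time R E = n%:R%:E].
Proof.
have [->|/set0P[m Em]] := eqVneq E set0.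
  by left; split=> //; rewrite /first_time image_set0 ereal_inf0.
right; have ex : exists n, `[< E n >] by exists m; apply/asboolP.
case: (ex_minnP ex) => n /asboolP En min; exists n; split=> //.
  by move=> k kn Ek; have := min k; rewrite leqNgt kn; move/(_ (asboolT Ek)).
apply/eqP; rewrite eq_le; apply/andP; split.
  by apply: ereal_inf_lbound; exists n.
apply: le_ereal_inf_tmp => _ [k Ek <-]; rewrite lee_fin ler_nat.
by apply: min; apply/asboolP.
Qed.

Lemma first_time_gt E t :
  (t%:R%:E < first_time R E)%E <-> forall k, (k <= t)%N -> ~ E k.
Proof.
have [[E0 ->]|[n [En min ->]]] := first_time_dichotomy E.
  by split=> [_ k _|_]; [rewrite E0|exact: ltry].
rewrite lte_fin ltr_nat; split=> [tn k kt|h].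
  by apply: min; exact: leq_ltn_trans tn.
by rewrite ltnNge; apply/negP => /h.
Qed.

Lemma first_time_eq0 E : first_time R E = 0%:R%:E <-> E 0%N.
Proof.
split=> [e|E0].
  apply: contrapT => nE; have /first_time_gt : forall k, (k <= 0)%N -> ~ E k.
    by move=> k; rewrite leqn0 => /eqP->.
  by rewrite e ltxx.
have [[e _]|[n [En min ->]]] := first_time_dichotomy E; first by rewrite e in E0.
by case: n min {En} => // n /(_ 0%N isT).
Qed.

Lemma first_time_eqS E t : first_time R E = t.+1%:R%:E <->
  (t%:R%:E < first_time R E)%E /\ ~ (t.+1%:R%:E < first_time R E)%E.
Proof.
split=> [->|]; first by rewrite ltxx lte_fin ltr_nat ltnSn.
have [[E0 ->]|[n [En min ->]]] := first_time_dichotomy E.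
  by rewrite !ltry => -[_]; case.
rewrite !lte_fin !ltr_nat => -[h1 /negP]; rewrite -leqNgt => h2.
by congr (_%:R%:E); apply/eqP; rewrite eqn_leq h1 h2.
Qed.
End FirstTime.

Arguments natural_times {R}.

Section ExitTime.
Context (R : realType) (d : measure_display) (Omega : measurableType d).
Context (P : probability Omega R) (L : nat) (Z : nat -> Omega -> int).
Hypothesis L_gt0 : (0 < L)%N.
Hypothesis walk : lazy_walk_from P ((L.+1)./2)%:Z Z.

Definition strip : seq int := [seq i%:Z | i <- iota 1 L].

Lemma strip_uniq : uniq strip.
Proof. by rewrite map_inj_uniq ?iota_uniq // => i j []. Qed.

Lemma mem_strip (z : int) : (z \in strip) = (1 <= z <= L%:Z).
Proof.
apply/mapP/idP => [[i]|h]; first by rewrite mem_iota => ? ->; lia.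
by exists `|z|%N; rewrite ?mem_iota; lia.
Qed.

Lemma exit_time_gt t : [set w | (t%:R%:E < exit_time R L Z w)%E] = stays Z strip t.
Proof.
apply/seteqP; split=> w /=.
  move=> /first_time_gt h k kt; have := h k kt; rewrite /= mem_strip.
  by move/negP; rewrite negbK.
by move=> h; apply/first_time_gt => k kt /=; rewrite -mem_strip h.
Qed.

(** The boundary values f 0 = f (L + 1) = 0 allow the sum over the strip to be
    written without a case distinction at its ends. *)
Lemma sum_lazy_walk_step (f : int -> R) i : (0 < i <= L)%N -> f 0 = 0 -> f L.+1 = 0 ->
  \sum_(z <- strip) @lazy_walk_step R i z * f z =
  2^-1 * f i + 4^-1 * (f i.-1 + f i.+1).
Proof.
move=> iL f0 fL.
have pick j : (j <= L.+1)%N -> \sum_(z <- strip) (z == j%:Z)%:R * f z = f j.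
  move=> jL; have [js|js] := boolP (j%:Z \in strip).
    rewrite (bigD1_seq j%:Z) ?strip_uniq //= eqxx mul1r big1 ?addr0 // => z /negPf->.
    by rewrite mul0r.
  rewrite big_seq big1 => [|z zs]; last first.
    by have [zj|] := eqVneq z; rewrite ?mul0r //; rewrite -zj zs in js.
  move: js; rewrite mem_strip => js.
  have [->|->] : j = 0%N \/ j = L.+1 by lia.
    by rewrite f0.
  by rewrite fL.
rewrite -!pick; try lia.
rewrite -big_split !mulr_sumr -big_split /=; apply: eq_bigr => z _.
rewrite -mulrDl !mulrA -mulrDl; congr (_ * _).
rewrite /lazy_walk_step; have [e|e] := eqVneq (i : int) z.
  have -> : (z == i.-1) = false by lia.
  have -> : (z == i.+1) = false by lia.
  by rewrite addr0 mulr0 addr0 mulr1.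
case: eqP => e2.
  have [->|->] : z = i.-1 \/ z = i.+1 by lia.
    have -> : (i.-1%:Z == i.+1) = false by lia.
    by rewrite eqxx addr0 mulr0 add0r mulr1.
  have -> : (i.+1%:Z == i.-1) = false by lia.
  by rewrite eqxx add0r mulr0 add0r mulr1.
have -> : (z == i.-1) = false by lia.
have -> : (z == i.+1) = false by lia.
by rewrite addr0 !mulr0 addr0.
Qed.

(** The survival recursion of the walk in the strip is the one that defines the
    delay of the time 0, up to complementation. *)
Lemma exit_time_tail t :
  P (stays Z strip t) = (1 - delay L (fun=> 1) t (L.+1)./2)%:E.
Proof.
have [Z0 mk] := walk.
rewrite (@survival _ _ _ _ _ _ _ strip ((L.+1)./2)%:Z
  (fun t z => 1 - delay L (fun=> 1) t `|z|%N) t strip_uniq _ Z0 mk) //.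
- by rewrite mem_strip; lia.
- by move=> z; rewrite mem_strip => zL; rewrite delay_in0 ?subr0 //; lia.
move=> {}t z; rewrite mem_strip => zL.
have [i iE] : exists i : nat, z = i by exists `|z|%N; lia.
rewrite iE in zL *.
rewrite (@sum_lazy_walk_step (fun z => 1 - delay L (fun=> 1) t `|z|%N)) /=; last 3 first.
- lia.
- by rewrite delay_out ?subrr.
- by rewrite delay_out ?subrr //; lia.
rewrite ?absz_nat /= delay_inS; last lia.
by lra.
Qed.

Lemma exit_time_pmf j :
  P (exit_time R L Z @^-1` [set j%:R%:E]) = (exit_pmf R L j (L.+1)./2)%:E.
Proof.
have mS n : measurable (stays Z strip n).
  by case: walk => _ [mF _ _]; apply: (mF n); exact: history_stays.
case: j => [|j].
  have -> : exit_time R L Z @^-1` [set 0%:R%:E] = ~` stays Z strip 0.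
    rewrite -exit_time_gt; apply/seteqP; split=> w /=.
      by move=> ->; rewrite ltxx.
    move=> h; apply/first_time_eq0; apply: contrapT => nE; apply: h.
    by apply/first_time_gt => k; rewrite leqn0 => /eqP->.
  rewrite probability_setC // exit_time_tail -EFinB exit_pmf0; congr _%:E; lra.
have -> : exit_time R L Z @^-1` [set j.+1%:R%:E] = stays Z strip j `\` stays Z strip j.+1.
  rewrite -!exit_time_gt; apply/seteqP; split=> w /=; by move/first_time_eqS.
have -> : (P (stays Z strip j `\` stays Z strip j.+1) =
    P (stays Z strip j) - P (stays Z strip j `&` stays Z strip j.+1))%E.
  apply: measureD => //.
  by apply: le_lt_trans (probability_le1 _ _) _ => //; exact: ltry.
rewrite (_ : _ `&` _ = stays Z strip j.+1); last first.
  apply/seteqP; split=> w /=; first by case.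
  by move=> h; split=> // k kj; apply: h; exact: leqW.
rewrite !exit_time_tail -EFinB exit_pmfS; congr _%:E; lra.
Qed.

(** Recorded as a statement about the law, because it has to be transferred to
    times that only share this law. *)
Lemma exit_time_natural : P (exit_time R L Z @^-1` ~` natural_times) = 0%E.
Proof.
rewrite (_ : _ @^-1` _ = set0) ?measure0 //; apply/seteqP; split=> // w /=; apply.
rewrite /exit_time.
have [[_ ->]|[n [_ _ e]]] := first_time_dichotomy R [set n | ~~ (1 <= Z n w <= L%:Z)].
  by left.
by right; exists n.
Qed.
End ExitTime.

(** * Independent sums *)

Section SumOfTimes.
Context (R : realType) (d : measure_display) (Omega : measurableType d).
Context (P : probability Omega R) (m : nat) (T : 'I_m -> Omega -> \bar R).
(** In the intended use the times have point probabilities a, and C r is the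
    distribution function of the sum of r of them. *)
Context (a : nat -> R) (C : nat -> nat -> R).

Hypothesis mT : forall i, measurable_fun setT (T i).
Hypothesis indep : mutually_independent P T.
Hypothesis pmfT : forall i j, P (T i @^-1` [set j%:R%:E]) = (a j)%:E.
Hypothesis natT : forall i, P (T i @^-1` ~` natural_times) = 0%E.
Hypothesis C_ge0 : forall r t, 0 <= C r t.
Hypothesis C0 : forall t, C 0 t = 1.
Hypothesis CS : forall r t, C r.+1 t = \sum_(j < t.+1) a j * C r (t - j)%N.

Lemma measurable_natural_times : measurable (@natural_times R).
Proof.
rewrite (_ : @natural_times R = [set +oo%E] `|` \bigcup_j [set j%:R%:E]).
  apply: measurableU; first exact: emeasurable_set1.
  by apply: bigcup_measurable => j _; exact: emeasurable_set1.
apply/seteqP; split=> x.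
  by case=> [->|[j ->]]; [left|right; exists j].
by case=> [->|[j _ ->]]; [left|right; exists j].
Qed.

Lemma natural_times_ge0 (x : \bar R) : natural_times x -> (0 <= x)%E.
Proof. by case=> [->//|[j ->]]; rewrite lee_fin ler0n. Qed.

Lemma measurable_preimage i B : measurable B -> measurable (T i @^-1` B).
Proof. by move=> mB; rewrite -[X in measurable X]setTI; exact: mT. Qed.

Definition first_sum r w : \bar R := (\sum_(i < m | (i < r)%N) T i w)%E.

(** The event that the first r times are natural and sum up to at most t, while
    the others are in prescribed sets: keeping the latter is what lets mutual
    independence be used one summand at a time. *)
Definition sum_event r t (B : 'I_m -> set (\bar R)) : set Omega :=
  (\bigcap_(i in [set: 'I_m]) (T i @^-1` (if (i < r)%N then natural_times else B i)))
  `&` [set w | (first_sum r w <= t%:R%:E)%E].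

Lemma measurable_first_sum r : measurable_fun setT (first_sum r).
Proof.
rewrite /first_sum; under eq_fun do rewrite big_mkcond /=.
apply: emeasurable_sum => i; by case: (i < r)%N => /=; [exact: mT|exact: measurable_cst].
Qed.

Lemma measurable_first_sum_le r t : measurable [set w | (first_sum r w <= t%:R%:E)%E].
Proof.
rewrite -[X in measurable X]setTI.
by apply: emeasurable_fun_infty_c => //; exact: measurable_first_sum.
Qed.

Lemma measurable_sum_event r t B :
  (forall i, measurable (B i)) -> measurable (sum_event r t B).
Proof.
move=> mB; apply: measurableI; last exact: measurable_first_sum_le.
apply: fin_bigcap_measurable => // i _; apply: measurable_preimage.
by case: ifP => // _; exact: measurable_natural_times.
Qed.

Lemma pmf_ge0 (i : 'I_m) j : 0 <= a j.
Proof. by rewrite -lee_fin -(pmfT i) measure_ge0. Qed.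

(** The event for r + 1 times is covered by the events for r times in which the
    next time is prescribed to be j <= t, with t - j left for the others. *)
Lemma sum_event_le r t B : (r <= m)%N -> (forall i, measurable (B i)) ->
  (P (sum_event r t B) <= (C r t)%:E * \prod_(i < m | (r <= i)%N) P (T i @^-1` B i))%E.
Proof.
elim: r t B => [|r IH] t B rm mB.
  rewrite C0 mul1e.
  have -> : (\prod_(i < m | (0 <= i)%N) P (T i @^-1` B i) =
    P (\bigcap_(i in [set` [set: 'I_m]%SET]) (T i @^-1` B i)))%E.
    by rewrite indep //; apply: eq_bigl => i; rewrite inE.
  apply: le_measure; rewrite ?inE.
  - exact: measurable_sum_event.
  - by apply: fin_bigcap_measurable => // i _; exact: measurable_preimage.
  - by move=> w [h _] i _; exact: h.
pose i0 := Ordinal rm.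
pose B' j i := if i == i0 then [set j%:R%:E] else B i.
have mB' j i : measurable (B' j i).
  by rewrite /B'; case: ifP => // _; exact: emeasurable_set1.
have mE j : measurable (sum_event r (t - j)%N (B' j)) by exact: measurable_sum_event.
(* The next time is natural or infinite, and the latter would make the sum
   exceed t. *)
have cover : sum_event r.+1 t B `<=`
    \big[setU/set0]_(j < t.+1) sum_event r (t - j)%N (B' j).
  move=> w [h]; rewrite /first_sum /= (bigD1 i0) //=.
  rewrite (eq_bigl (fun i : 'I_m => (i < r)%N)); last first.
    by move=> i; rewrite -(inj_eq val_inj) /= ltnS ltn_neqAle andbC.
  rewrite -/(first_sum r w) => le.
  have s0 : (0 <= first_sum r w)%E.
    apply: sume_ge0 => i ir; apply: natural_times_ge0.
    by have := h i I; rewrite /= ltnS (ltnW ir).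
  have := h i0 I; rewrite /= ltnSn => -[e|[j e]].
    by move: le; rewrite e addye // -ltNye (lt_le_trans _ s0).
  move: le; rewrite e => le.
  have jt : (j <= t)%N.
    rewrite -(ler_nat R) -lee_fin; apply: le_trans le; exact: leeDl.
  rewrite -(bigcup_mkord _ (fun j => sum_event r (t - j)%N (B' j))); exists j => //=; split.
    move=> i _; have := h i I; rewrite /= /B'.
    have [->|ii0] := eqVneq i i0; first by rewrite /= ltnn.
    by move: ii0; rewrite -val_eqE /= ltnS leq_eqVlt => /negPf->.
  by rewrite /= natrB // EFinB leeBrDl // addeC.
pose Q := (\prod_(i < m | (r < i)%N) P (T i @^-1` B i))%E.
have Q0 : (0 <= Q)%E by apply: prode_ge0.
apply: (@le_trans _ _ (\sum_(j < t.+1) P (sum_event r (t - j)%N (B' j)))%E).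
  apply: (@content_subadditive _ _ _ P _ (fun j => sum_event r (t - j)%N (B' j)) t.+1) => //.
  exact: measurable_sum_event.
apply: (@le_trans _ _ (\sum_(j < t.+1) (a j * C r (t - j)%N)%:E * Q)%E).
  apply: lee_sum => j _; apply: le_trans (IH _ _ (ltnW rm) (mB' j)) _.
  rewrite (bigD1 i0) //= /B' eqxx pmfT muleA -EFinM [C _ _ * _]mulrC.
  rewrite (_ : (\prod_(i < m | _) _)%E = Q) //.
  apply: eq_big => i; last by case/andP=> _ /negPf->.
  by rewrite -(inj_eq val_inj) /= ltn_neqAle eq_sym andbC.
rewrite CS -ge0_sume_distrl ?sumEFin // => j _.
by rewrite lee_fin mulr_ge0 // (pmf_ge0 i0).
Qed.

(** Almost surely all times are natural, so up to a null event the complement is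
    contained in sum_event m t. *)
Lemma sum_tail_ge t :
  ((1 - C m t)%:E <= P [set w | t%:R%:E < \sum_(i < m) T i w])%E.
Proof.
have mN := measurable_natural_times.
have natT1 i : P (T i @^-1` natural_times) = 1%E.
  rewrite -[natural_times]setCK preimage_setC probability_setC ?natT ?sube0 //.
  exact: (measurable_preimage i (measurableC mN)).
pose G := \bigcap_(i in [set` [set: 'I_m]%SET]) (T i @^-1` natural_times).
have mG : measurable G.
  by apply: fin_bigcap_measurable => // i _; exact: measurable_preimage.
have PG : P G = 1%E.
  by rewrite indep // big1.
have fsE w : first_sum m w = (\sum_(i < m) T i w)%E.
  by apply: eq_bigl => i; rewrite ltn_ord.
have mS := measurable_first_sum_le m t.
have -> : [set w | (t%:R%:E < \sum_(i < m) T i w)%E] =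
    ~` [set w | (first_sum m w <= t%:R%:E)%E].
  by apply/seteqP; split=> w /=; rewrite fsE ltNge => /negP.
rewrite probability_setC // EFinB leeB //.
apply: (@le_trans _ _ (P (sum_event m t (fun=> setT) `|` ~` G))).
  apply: le_measure; rewrite ?inE //.
    by apply: measurableU; [exact: measurable_sum_event|exact: measurableC].
  move=> w /= h; have [Gw|nG] := pselect (G w); last by right.
  by left; split=> // i _; rewrite ltn_ord; apply: Gw; rewrite /= inE.
apply: le_trans (measureU2 _ _ _) _; [exact: measurable_sum_event|exact: measurableC|].
rewrite [X in (_ + X)%E](_ : _ = 0%E) ?adde0; last first.
  by rewrite [LHS](probability_setC P mG) PG subee.
apply: le_trans (sum_event_le _ _ _) _ => //.
by rewrite big_pred0 ?mule1 // => i; rewrite leqNgt ltn_ord.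
Qed.

End SumOfTimes.

(** * A chain driven by independent base-4 digits *)

Section Digits.
Variable R : realType.
Local Notation mu := (@lebesgue_measure R).
Definition uniform_law : probability (measurableTypeR R) R := uniform_prob (@ltr01 R).
Local Notation P := uniform_law.

(** The first n base-4 digits of w, read as a natural number; they form a
    uniform element of {0, ..., 4^n - 1}, and each further digit is independent
    of the previous ones. *)
Definition digits n (w : R) : nat := Num.truncn (4 ^+ n * w).

Lemma digitsS n w : (digits n.+1 w %/ 4)%N = digits n w.
Proof.
rewrite /digits exprS -mulrA; set x := 4 ^+ n * w.
have [x0|x0] := leP 0 x; last first.
  by have [-> ->] : Num.truncn (4 * x) = 0%N /\ Num.truncn x = 0%N;
    [split; apply/truncn0Pn; rewrite -ltNge; lra|rewrite div0n].
have /andP[h1 h2] := truncn_itv x0.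
have /andP[h3 h4] : (Num.truncn (4 * x))%:R <= 4 * x < (Num.truncn (4 * x)).+1%:R.
  by apply: truncn_itv; lra.
have h5 : (4 * Num.truncn x)%:R < (Num.truncn (4 * x)).+1%:R :> R.
  by rewrite natrM; lra.
have h6 : (Num.truncn (4 * x))%:R < (4 * (Num.truncn x).+1)%:R :> R.
  by rewrite natrM; lra.
by rewrite !ltr_nat in h5 h6; lia.
Qed.

Lemma digits_eq n j w : 0 <= w -> (digits n w == j) = (j%:R / 4 ^+ n <= w < j.+1%:R / 4 ^+ n).
Proof.
move=> w0; have p4 : 0 < 4 ^+ n :> R by rewrite exprn_gt0.
rewrite truncn_eq ?mulr_ge0 ?(ltW p4) //.
by rewrite ler_pdivrMr // ltr_pdivlMr // mulrC.
Qed.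

Lemma uniformE A : measurable A -> P A = mu (A `&` `[0, 1]).
Proof.
move=> mA; rewrite [P A]/(uniform_prob _ _) /uniform_prob integral_uniform_pdf.
rewrite (eq_integral (cst 1%E)).
  by rewrite integral_cst ?mul1e //; exact: measurableI.
move=> x; rewrite inE => -[_]; rewrite /= in_itv /= /uniform_pdf => ->.
by rewrite subr0 invr1.
Qed.

Lemma measurable_digits n (B : set nat) : measurable (digits n @^-1` B).
Proof.
rewrite (_ : _ @^-1` _ = \bigcup_(j in B) (digits n @^-1` [set j])); last first.
  by apply/seteqP; split=> [w /= h|w [j Bj /= ->]//]; exists (digits n w).
apply: bigcup_measurable => j _.
have mle k : measurable [set w | (digits n w <= k)%N].
  rewrite (_ : [set w | _] = `]-oo, k.+1%:R / 4 ^+ n[%classic) //.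
  apply/seteqP; split=> w /=;
    by rewrite in_itv /= ltr_pdivlMr ?exprn_gt0 // mulrC truncn_le_nat.
case: j => [|j].
  rewrite (_ : _ @^-1` _ = [set w | (digits n w <= 0)%N]) //.
  by apply/seteqP; split=> w /=; rewrite leqn0 => /eqP.
rewrite (_ : _ @^-1` _ = [set w | (digits n w <= j.+1)%N] `\` [set w | (digits n w <= j)%N]).
  exact: measurableD.
apply/seteqP; split=> w /=; first by move=> ->; rewrite ltnn.
by case=> h1 /negP; rewrite -ltnNge => h2; apply/eqP; rewrite eqn_leq h1 h2.
Qed.

(** On [0, 1) the event that the first n digits are j is an interval of length
    4^-n. *)
Lemma prob_digits_eq n j : (j < 4 ^ n)%N -> P (digits n @^-1` [set j]) = (4 ^- n)%:E.
Proof.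
move=> jn; have p4 : 0 < 4 ^+ n :> R by rewrite exprn_gt0.
rewrite uniformE; last exact: measurable_digits.
rewrite (_ : _ `&` _ = `[j%:R / 4 ^+ n, j.+1%:R / 4 ^+ n[%classic).
  rewrite lebesgue_measure_itv /= lte_fin ltr_pM2r ?invr_gt0 // ltr_nat ltnSn.
  by rewrite -EFinD -mulrBl -natrB // subSnn mul1r.
have j1 : j.+1%:R / 4 ^+ n <= 1 :> R.
  by rewrite ler_pdivrMr // mul1r -natrX ler_nat.
have j0 : 0 <= j%:R / 4 ^+ n :> R by rewrite mulr_ge0 ?invr_ge0 ?ler0n ?(ltW p4).
apply/seteqP; split=> w /=; rewrite !in_itv /=.
  by case=> /eqP e /andP[w0 _]; rewrite -digits_eq.
move=> /andP[h1 h2]; have w0 : 0 <= w by exact: le_trans h1.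
split; first by apply/eqP; rewrite digits_eq // h1.
by rewrite w0 (le_trans (ltW h2)).
Qed.

Lemma prob_digits n (b : nat -> bool) :
  P [set w | b (digits n w)] = (\sum_(j < 4 ^ n) (b j)%:R * 4 ^- n)%:E.
Proof.
have mb (c : nat -> bool) : measurable [set w | c (digits n w)].
  exact: (measurable_digits n [set j | c j]).
have msum (c : nat -> bool) : (forall j, c j -> j < 4 ^ n)%N ->
    P [set w | c (digits n w)] = (\sum_(j < 4 ^ n) (c j)%:R * 4 ^- n)%:E.
  move=> cn; apply: (etrans (@measure_partition_seq _ _ _ P _ _ (digits n)
      (iota 0 (4 ^ n)) (iota_uniq _ _) (mb c) _ _)).
  - by move=> j; exact: measurable_digits.
  - by move=> w /cn; rewrite /= mem_iota.
  rewrite -sumEFin (_ : iota 0 _ = index_iota 0 (4 ^ n)); last by rewrite /index_iota subn0.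
  rewrite big_mkord; apply: eq_bigr => j _.
  have [cj|cj] := boolP (c j).
    rewrite mul1r -(@prob_digits_eq n j) //; congr (P _).
    by apply/seteqP; split=> w /= => [[]|->].
  rewrite mul0r (_ : _ `&` _ = set0) ?measure0 //.
  by apply/seteqP; split=> // w /= [cw e]; rewrite -e cw in cj.
have P1 : P [set w | (digits n w < 4 ^ n)%N] = 1%E.
  rewrite (msum (fun j => j < 4 ^ n)%N) // (eq_bigr (fun=> 4 ^- n)).
    by rewrite sumr_const card_ord -(mulr_natl (4 ^- n)) natrX divff //.
  by move=> j _; rewrite ltn_ord mul1r.
have P0 : P (~` [set w | (digits n w < 4 ^ n)%N]) = 0%E.
  by rewrite probability_setC ?P1 ?subee //; exact: (mb (fun j => j < 4 ^ n)%N).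
transitivity (P [set w | (b (digits n w)) && (digits n w < 4 ^ n)%N]).
  rewrite [LHS](_ : _ = P ([set w | b (digits n w) && (digits n w < 4 ^ n)%N] `|`
      [set w | b (digits n w) && ~~ (digits n w < 4 ^ n)%N])); last first.
    congr (P _); apply/seteqP; split=> w /=.
      by move=> ->; case: (digits n w < _)%N; [left|right].
    by case=> /andP[].
  rewrite [LHS]measureU; first 1 last.
  - exact: (mb (fun j => b j && (j < 4 ^ n)%N)).
  - exact: (mb (fun j => b j && ~~ (j < 4 ^ n)%N)).
  - by apply/seteqP; split=> // w /= [/andP[_ ->] /andP[]].
  rewrite [X in (_ + X)%E](_ : _ = 0%E) ?adde0 //.
  apply/eqP; rewrite eq_le; apply/andP; split; last exact: measure_ge0.
  rewrite -P0; apply: le_measure; rewrite ?inE.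
  - exact: (mb (fun j => b j && ~~ (j < 4 ^ n)%N)).
  - by apply: measurableC; exact: (mb (fun j => j < 4 ^ n)%N).
  - by move=> w /= /andP[_ /negP].
rewrite (msum (fun j => b j && (j < 4 ^ n)%N)).
  by congr _%:E; apply: eq_bigr => j _; rewrite ltn_ord andbT.
by move=> j /andP[].
Qed.

Section DrivenChain.
Variables (S : Type) (step : nat -> S -> S) (v0 : S).

(** The last digit of j acts last, so that dropping it by division undoes the
    last step. *)
Fixpoint run n (j : nat) : S :=
  if n is n'.+1 then step (j %% 4) (run n' (j %/ 4)) else v0.

Definition driven n w : S := run n (digits n w).

Lemma drivenS n w : driven n.+1 w = step (digits n.+1 w %% 4) (driven n w).
Proof. by rewrite /driven /= digitsS. Qed.

Lemma digits_determine n k w w' : (k <= n)%N -> digits n w = digits n w' ->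
  driven k w = driven k w'.
Proof.
move=> kn e; rewrite /driven; suff -> : digits k w = digits k w' by [].
move: e; rewrite -{1 2}(subnKC kn); elim: (n - k)%N => [|m IH]; first by rewrite addn0.
by rewrite addnS => e; apply: IH; rewrite -(digitsS _ w) -(digitsS _ w') e.
Qed.

(** The events determined by the first n digits, stated as an invariance, which
    is visibly stable under complements and unions. *)
Definition digit_event n (A : set R) : Prop :=
  forall w w', digits n w = digits n w' -> A w -> A w'.

Lemma history_digit_event (S' : eqType) (f : S -> S') n A :
  history (fun k w => f (driven k w)) n A -> digit_event n A.
Proof.
move: A; apply: smallest_sub.
  split=> [w w' _ []|A hA w w' e [_ nA]|F hF w w' e [k _ Fk]].
  - by split=> // Aw'; apply: nA; exact: hA Aw'.
  - by exists k => //; exact: hF Fk.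
move=> A [k [s [kn ->]]] w w' e /=.
by rewrite (digits_determine kn e).
Qed.

Lemma digit_event_measurable n A : digit_event n A -> measurable A.
Proof.
move=> hA; rewrite (_ : A = digits n @^-1` (digits n @` A)).
  exact: measurable_digits.
apply/seteqP; split=> w; first by move=> Aw; exists w.
by case=> w' Aw' e; exact: hA Aw'.
Qed.

Lemma sum_digits (F : nat -> nat -> R) n :
  \sum_(j < 4 * n) F (j %/ 4)%N (j %% 4)%N = \sum_(j < n) \sum_(u < 4) F j u.
Proof.
elim: n => [|n IH]; first by rewrite !big_ord0.
have E u : (u < 4)%N -> F ((4 * n + u) %/ 4)%N ((4 * n + u) %% 4)%N = F n u.
  by move=> u4; rewrite mulnC divnMDl // divn_small // addn0 modnMDl modn_small.
rewrite [RHS]big_ord_recr /= -IH mulnS addnC big_split_ord /=; congr (_ + _).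
by apply: eq_bigr => u _; rewrite E.
Qed.

(** Any function f of the driven chain is a Markov chain as soon as one uniform
    digit moves f v according to p (f v); this serves for the pair and for both
    of its coordinates at once. *)
Lemma driven_markov (S' : eqType) (f : S -> S') (p : S' -> S' -> R)
    (F : nat -> set (set R)) :
  (forall v s', p (f v) s' = \sum_(u < 4) 4^-1 * (f (step u v) == s')%:R) ->
  (forall n A, F n A -> digit_event n A) ->
  (forall n s, F n ((fun w => f (driven n w)) @^-1` [set s])) ->
  markov_chain_wrt P F p (fun n w => f (driven n w)).
Proof.
move=> hp FD Fad; split=> //.
  by move=> n A /FD; exact: digit_event_measurable.
move=> n A s s' /FD hA.
pose b j := `[< exists2 w, A w & digits n w = j >] && (f (run n j) == s).
have bE w : b (digits n w) <-> A w /\ f (driven n w) = s.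
  rewrite /b; split=> [/andP[/asboolP[w' Aw' e] /eqP]|[Aw fs]].
    by split=> //; exact: hA Aw'.
  by apply/andP; split; [apply/asboolP; exists w|apply/eqP].
have AE : A `&` (fun w => f (driven n w)) @^-1` [set s] = [set w | b (digits n w)].
  by apply/seteqP; split=> w /bE.
pose b' j := b (j %/ 4)%N && (f (step (j %% 4) (run n (j %/ 4))) == s').
rewrite (_ : _ `&` _ `&` _ = [set w | b' (digits n.+1 w)]); last first.
  apply/seteqP; split=> w /=; rewrite drivenS /b' /driven digitsS.
    by case=> /bE -> ->; rewrite eqxx.
  by case/andP=> /bE ? /eqP.
rewrite AE (prob_digits n b) (prob_digits n.+1 b') -EFinM; congr _%:E.
rewrite expnS (sum_digits (fun j u => (b j && (f (step u (run n j)) == s'))%:R * 4 ^- n.+1)).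
rewrite mulr_suml; apply: eq_bigr => j _; have [bj|bj] := boolP (b j); last first.
  by rewrite big1 ?mul0r // => u _; rewrite mul0r.
move: bj => /andP[_ /eqP <-]; rewrite hp mul1r mulr_sumr; apply: eq_bigr => u _.
by rewrite exprS invfM /=; ring.
Qed.

End DrivenChain.
End Digits.

(** * The coupling *)

Section Coupling.
Variables (R : realType) (N J0 JN : nat).
Hypotheses (hJ0 : (1 < J0 <= N)%N) (hJN : (JN.+1 < N)%N).
Local Notation site := 'I_N.+1.

(** Digits 0 and 1 mean staying put. *)
Definition move_site (u : nat) (b : bool) (x : site) : site :=
  if (u < 2)%N then x else inord (neighbor N J0 JN b x).

(** Digits 2 and 3 send the first walker to the left and to the right. *)
Definition coupled_step (u : nat) (v : site * site) : site * site :=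
  (move_site u (u == 3) v.1, move_site u (partner_dir N J0 JN (u == 3) v.1 v.2) v.2).

Lemma move_site_val u b (x : site) :
  move_site u b x = (if (u < 2)%N then x : nat else neighbor N J0 JN b x) :> nat.
Proof.
rewrite /move_site; case: ifP => // _; rewrite inordK // ltnS.
by apply: neighbor_le; [lia|lia|rewrite -ltnS].
Qed.

Lemma coupled_step_diag u x : (coupled_step u (x, x)).1 = (coupled_step u (x, x)).2.
Proof. by rewrite /coupled_step /= /partner_dir /mirrored eqxx. Qed.

Lemma trans_neighbor (x y : site) :
  @trans N J0 JN R x y = 2^-1 * (x == y)%:R
   + 4^-1 * ((neighbor N J0 JN false x == y)%:R + (neighbor N J0 JN true x == y)%:R).
Proof.
rewrite /trans /jump_law /neighbor -(inj_eq val_inj) /=.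
have := ltn_ord x; have := ltn_ord y.
move: (nat_of_ord x) (nat_of_ord y) => {}x {}y yN xN.
have [<-|xy] := eqVneq x y.
  rewrite subrr /= mulr1.
  have -> : ((if x == 0 then J0 else x.-1) == x)%N = false by case: (x =P 0%N) => /=; lia.
  have -> : ((if x == N then JN else x.+1) == x)%N = false by case: (x =P N) => /=; lia.
  by rewrite addr0 mulr0 addr0.
have -> : (`|x%:Z - y%:Z|%N == 0%N) = false by lia.
rewrite mulr0 add0r; have [d1|d1] := eqVneq `|x%:Z - y%:Z|%N 1%N.
  have [yE|yE] : y = x.+1 \/ x = y.+1 by lia.
    have -> : ((if x == 0 then J0 else x.-1) == y)%N = false by case: (x =P 0%N) => /=; lia.
    have -> : ((if x == N then JN else x.+1) == y)%N by case: (x =P N) => /=; lia.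
    by rewrite add0r mulr1.
  have -> : ((if x == 0 then J0 else x.-1) == y)%N by case: (x =P 0%N) => /=; lia.
  have -> : ((if x == N then JN else x.+1) == y)%N = false by case: (x =P N) => /=; lia.
  by rewrite addr0 mulr1.
have [x0|x0] /= := eqVneq x 0%N.
  have -> : ((if x == N then JN else x.+1) == y)%N = false by case: (x =P N) => /=; lia.
  by rewrite addr0 eq_sym.
have -> : (x.-1 == y) = false by lia.
have [xN'|xN'] /= := eqVneq x N; first by rewrite add0r eq_sym.
have -> : (x.+1 == y) = false by lia.
by rewrite addr0 mulr0.
Qed.

Lemma trans_fst v (x' : site) :
  @trans N J0 JN R v.1 x' = \sum_(u < 4) 4^-1 * ((coupled_step u v).1 == x')%:R.
Proof.
rewrite trans_neighbor !big_ord_recr big_ord0 /= /coupled_step /=.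
by rewrite -!(inj_eq val_inj) /= !move_site_val /=; lra.
Qed.

Lemma trans_snd v (y' : site) :
  @trans N J0 JN R v.2 y' = \sum_(u < 4) 4^-1 * ((coupled_step u v).2 == y')%:R.
Proof.
rewrite trans_neighbor !big_ord_recr big_ord0 /= /coupled_step /=.
rewrite -!(inj_eq val_inj) /= !move_site_val /= /partner_dir.
by case: mirrored => /=; lra.
Qed.

Definition coupled_trans (v v' : site * site) : R :=
  \sum_(u < 4) 4^-1 * (coupled_step u v == v')%:R.

Lemma sum_coupled_trans (A : seq (site * site)) (f : site * site -> R) v :
  uniq A -> (forall v', v' \notin A -> f v' = 0) ->
  \sum_(v' <- A) coupled_trans v v' * f v' = \sum_(u < 4) 4^-1 * f (coupled_step u v).
Proof.
move=> uA fA.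
transitivity (\sum_(v' <- A) \sum_(u < 4) 4^-1 * ((coupled_step u v == v')%:R * f v')).
  by apply: eq_bigr => v' _; rewrite mulr_suml; apply: eq_bigr => u _; rewrite mulrA.
rewrite exchange_big; apply: eq_bigr => u _; rewrite -mulr_sumr; congr (_ * _).
have [vA|vA] := boolP (coupled_step u v \in A).
  rewrite (bigD1_seq (coupled_step u v)) //= eqxx mul1r big1 ?addr0 // => v' /negPf e.
  by rewrite eq_sym e mul0r.
rewrite big_seq big1 ?fA // => v' v'A; have [e|_] := eqVneq; last by rewrite mul0r.
by rewrite e v'A in vA.
Qed.

Lemma coupled_trans_stochastic : stochastic coupled_trans.
Proof.
split=> [v v'|v]; first by apply: sumr_ge0 => u _; rewrite mulr_ge0 ?invr_ge0 ?ler0n.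
have := @sum_coupled_trans (index_enum _) (fun=> 1) v (index_enum_uniq _).
rewrite (eq_bigr (coupled_trans v)) => [->|v' _]; last by rewrite mulr1.
  by rewrite !big_ord_recr big_ord0 /=; lra.
by move=> v'; rewrite mem_index_enum.
Qed.

(** The probability that the coordinated walkers started from x and y have met
    by time t. *)
Fixpoint meet t x y : R :=
  if x == y then 1 else if t is t'.+1 then
    2^-1 * meet t' x y
    + 4^-1 * (meet t' (neighbor N J0 JN false x)
                (neighbor N J0 JN (partner_dir N J0 JN false x y) y)
    + meet t' (neighbor N J0 JN true x)
                (neighbor N J0 JN (partner_dir N J0 JN true x y) y))
  else 0.

Lemma meet_diag t x : meet t x x = 1.
Proof. by case: t => [|t] /=; rewrite eqxx. Qed.

Lemma meet_ge0 t x y : 0 <= meet t x y.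
Proof.
elim: t x y => [|t IH] x y /=; case: eqP => // _.
by rewrite addr_ge0 ?mulr_ge0 ?addr_ge0 ?invr_ge0 ?IH ?ler0n.
Qed.

Variables (x y : site).

Definition pair_walk : nat -> measurableTypeR R -> site * site :=
  @driven R _ coupled_step (x, y).
Definition walk_fst n (w : measurableTypeR R) := (pair_walk n w).1.
Definition walk_snd n (w : measurableTypeR R) := (pair_walk n w).2.
Local Notation P := (uniform_law R).

Lemma markovian_coupling_walks : markovian_coupling P (@trans N J0 JN R) walk_fst walk_snd.
Proof.
have WE : pair_process walk_fst walk_snd = pair_walk.
  by apply/funext => n; apply/funext => w; rewrite /pair_process -surjective_pairing.
have WF n A : history pair_walk n A -> digit_event n A.
  exact: (@history_digit_event R _ coupled_step (x, y) _ id).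
have Wsub n (S' : eqType) (f : site * site -> S') s :
    history pair_walk n ((fun w => f (pair_walk n w)) @^-1` [set s]).
  rewrite (_ : _ @^-1` _ =
      [set w | pair_walk n w \in [seq v <- enum (predT : pred (site * site)) | f v == s]]).
    exact: history_preimage_seq.
  apply/seteqP; split=> w /=; rewrite mem_filter mem_enum andbT; first by move=> ->.
  by move/eqP.
have mk (S' : eqType) (f : site * site -> S') p :
    (forall v s', p (f v) s' = \sum_(u < 4) 4^-1 * (f (coupled_step u v) == s')%:R) ->
    markov_chain_wrt P (history pair_walk) p (fun n w => f (pair_walk n w)) /\
    markov_chain P p (fun n w => f (pair_walk n w)).
  move=> hp; split; first exact: (driven_markov hp).
  apply: (driven_markov hp); first exact: history_digit_event.
  by move=> n s; exact: history_preimage.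
have [X1 X2] := mk _ fst _ trans_fst.
have [Y1 Y2] := mk _ snd _ trans_snd.
rewrite /markovian_coupling WE; split=> //.
- split=> // w n k e; move/subnKC=> <-; elim: (k - n)%N => [|m IH]; first by rewrite addn0.
  rewrite addnS /walk_fst /walk_snd /pair_walk !drivenS -/pair_walk.
  move: IH; rewrite /walk_fst /walk_snd -/pair_walk.
  case: (pair_walk (n + m) w) => a b /= ->; exact: coupled_step_diag.
- exists coupled_trans; split; first exact: coupled_trans_stochastic.
  by have [] := mk _ id coupled_trans (fun _ _ => erefl).
Qed.

(** The coupling time exceeds t when the pair has stayed off the diagonal up to
    time t. *)
Lemma coupling_time_tail t :
  P [set w | (t%:R%:E < coupling_time R walk_fst walk_snd w)%E] = (1 - meet t x y)%:E.
Proof.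
pose A := enum [pred v : site * site | v.1 != v.2].
have -> : [set w | (t%:R%:E < coupling_time R walk_fst walk_snd w)%E] = stays pair_walk A t.
  apply/seteqP; split=> w /=.
    by move/first_time_gt => h k kt; rewrite mem_enum inE; apply/eqP; exact: h.
  move=> h; apply/first_time_gt => k kt /=.
  by have := h k kt; rewrite mem_enum inE => /eqP.
have W0 w : pair_walk 0 w = (x, y) by [].
have [exy|nxy] := eqVneq x y.
  rewrite exy meet_diag subrr (_ : stays _ _ _ = set0) ?measure0 //.
  apply/seteqP; split=> // w /(_ 0%N isT); rewrite W0 mem_enum inE /= exy.
  by rewrite eqxx.
have mkW : markov_chain P coupled_trans pair_walk.
  apply: (@driven_markov R _ coupled_step (x, y) _ id) => //.
    exact: (@history_digit_event R _ coupled_step (x, y) _ id).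
  by move=> n s; exact: history_preimage.
rewrite (@survival _ _ _ _ _ coupled_trans pair_walk A (x, y)
  (fun t v => 1 - meet t v.1 v.2) t _ _ W0 mkW) //.
- exact: enum_uniq.
- by rewrite mem_enum.
- by move=> v; rewrite mem_enum inE -(inj_eq val_inj) /= => /negPf->; rewrite subr0.
move=> {}t v; rewrite mem_enum inE -(inj_eq val_inj) => vne.
rewrite (@sum_coupled_trans _ (fun v => 1 - meet t v.1 v.2)) ?enum_uniq //; last first.
  by move=> v'; rewrite mem_enum inE negbK => /eqP->; rewrite meet_diag subrr.
rewrite !big_ord_recr big_ord0 /= !move_site_val /= (negPf vne).
by lra.
Qed.
End Coupling.

(** The comparison, for a pair of rank at most m in any ladder: both sides are
    expressed by the distribution function of a sum of m exit times. *)
Lemma coupling_time_dominated (R : realType) (N J0 JN L m : nat)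
    (C : nat -> nat -> nat -> nat -> Prop) (x y : 'I_N.+1) (r i : nat)
    (d' : measure_display) (Omega' : measurableType d') (P' : probability Omega' R)
    (T : 'I_m -> {RV P' >-> \bar R}) (t : nat) :
  (1 < J0 <= N)%N -> (JN.+1 < N)%N -> (0 < L)%N ->
  ladder N J0 JN L C -> C x y r i -> (r <= m)%N ->
  mutually_independent P' (fun j => T j : Omega' -> \bar R) ->
  (forall j, exists (d1 : measure_display) (Omega1 : measurableType d1)
                    (P1 : probability Omega1 R) (Z : nat -> Omega1 -> int),
      distributed_as_exit_time P1 L Z (T j)) ->
  (uniform_law R [set w | t%:R%:E <
      coupling_time R (walk_fst J0 JN x y) (walk_snd J0 JN x y) w]
   <= P' [set w | t%:R%:E < \sum_(j < m) T j w])%E.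
Proof.
move=> hJ0 hJN L_gt0 lad Cxy rm indep hT.
rewrite coupling_time_tail //.
have le1 : exit_sum_cdf R L m t <= meet R N J0 JN t x y.
  have [r0 iL _ _] := lad _ _ _ _ Cxy.
  (* No starting position is slower than the middle, and adding times only
     delays further. *)
  apply: (@le_trans _ _ (exit_sum_cdf R L r t)); first exact: exit_sum_cdf_le.
  apply: (@le_trans _ _ (delay L (exit_sum_cdf R L r.-1) t i)).
    rewrite -{1}(prednK r0) /=; apply: delay_middle_le; last by case/andP: iL => _ /leqW.
      exact: exit_sum_cdf_ge0.
    exact: exit_sum_cdf_nondecreasing.
  apply: (meet_ge_exit_sum_cdf _ _ lad) (or_introl Cxy); try lia.
  - exact: meet_ge0.
  - exact: meet_diag.
  - by move=> u a b _ _ /= /negPf->.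
apply: (@le_trans _ _ (1 - exit_sum_cdf R L m t)%:E); first by rewrite lee_fin; lra.
apply: (@sum_tail_ge _ _ _ P' m (fun j => T j : Omega' -> \bar R)
  (fun j => exit_pmf R L j (L.+1)./2) (exit_sum_cdf R L)) => //.
- move=> k j; case: (hT k) => disp [U1 [P1 [Z [walk lawT]]]].
  rewrite -(exit_time_pmf L_gt0 walk) -lawT //; exact: emeasurable_set1.
- move=> k; case: (hT k) => disp [U1 [P1 [Z [walk lawT]]]].
  rewrite -(exit_time_natural P1 L Z) -lawT //.
  exact: measurableC (measurable_natural_times R).
- exact: exit_sum_cdf_ge0.
- by move=> s u /=; exact: delay_convolution.
Qed.

Unset Implicit Arguments.

Theorem theorem3 (R : realType) (N J0 JN : nat)
    (hN : (4 %| N)%N)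
    (hJ0odd : odd J0) (hJ0 : (3 <= J0 <= N - 3)%N)
    (hJNodd : odd JN) (hJN : (3 <= JN <= N - 3)%N)
    (x y : 'I_N.+1) (hxy : (x < y)%N)
    (heven : ~~ odd (y - x)) (hrho : (2 <= y - x <= rho N J0 JN)%N) :
  exists (d : measure_display) (Omega : measurableType d)
         (P : probability Omega R) (X Y : nat -> Omega -> 'I_N.+1),
    [/\ markovian_coupling P (@trans N J0 JN R) X Y,
        forall w, X 0%N w = x /\ Y 0%N w = y
      & forall (d' : measure_display) (Omega' : measurableType d')
               (P' : probability Omega' R)
               (T : 'I_(num_copies N J0 JN) -> {RV P' >-> \bar R}),
          mutually_independent P' (fun i => T i : Omega' -> \bar R) ->
          (forall i, exists (d1 : measure_display) (Omega1 : measurableType d1)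
                            (P1 : probability Omega1 R)
                            (Z : nat -> Omega1 -> int),
              distributed_as_exit_time P1 (L0 N J0 JN) Z (T i)) ->
          forall t : nat,
            (P [set w | t%:R%:E < coupling_time R X Y w]
             <= P' [set w | t%:R%:E < \sum_(i < num_copies N J0 JN) T i w])%E].
Proof.
have hN2 : ~~ odd N by lia.
have [C [lad start]] := ladder_exists hN2 hJ0odd hJNodd hJ0 hJN.
have xyN : (x < y <= N)%N by rewrite hxy -ltnS ltn_ord.
have [r [i [Cxy rb]]] := start x y xyN heven (proj2 (andP hrho)).
have L0_gt0 : (0 < L0 N J0 JN)%N by rewrite /L0 half_gt0 !leq_max; lia.
have hJ0' : (1 < J0 <= N)%N by lia.
have hJN' : (JN.+1 < N)%N by lia.
exists _, (measurableTypeR R), (uniform_law R),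
  (walk_fst J0 JN x y), (walk_snd J0 JN x y); split.
- exact: markovian_coupling_walks.
- by [].
- move=> d' Omega' P' T indep hT t.
  exact: (coupling_time_dominated t hJ0' hJN' L0_gt0 lad Cxy rb indep hT).
Qed.
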